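(* Let $m\geq 1$ and let $x\colon\mathbb{N}\to\mathbb{Q}/\mathbb{Z}$ be a sequence satisfying $$a_m x(n+m)+\cdots+a_1 x(n+1)+x(n)=0\quad\text{for all } n\geq 0$$ for some integers $a_1,\dots,a_m$ (an inverse monic linear recurrence sequence). Then the zero set $\{n\in\mathbb{N}\mid x(n)=0\}$ is almost periodic.
   Context: $\mathbb{Z}_+$ is the set of positive integers and $\mathbb{N}=\mathbb{Z}_+\cup\{0\}$. An arithmetic progression is a set of the form $\{a+bm\mid m\in\mathbb{N}\}$ with $a,b\in\mathbb{N}$ (in particular it can be a singleton). A subset $A\subseteq\mathbb{N}$ is very sparse if, for each $m\in\mathbb{Z}_+$, $|A\cap[0,n]|=o(\log^{(m)}(n))$ as $n\to\infty$, where $\log^{(m)}$ is the $m$-th iterated logarithm. A subset of $\mathbb{N}$ is almost periodic if it is the union of finitely many arithmetic progressions along with a very sparse set. *)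

(* Defs.v *)
From HB Require Import structures.
From mathcomp Require Import all_boot all_order all_algebra.
From mathcomp Require Import all_classical all_reals all_analysis.

Set Implicit Arguments.
Unset Strict Implicit.
Unset Printing Implicit Defensive.

Import Order.TTheory GRing.Theory Num.Theory.
Import numFieldNormedType.Exports.

Local Open Scope classical_set_scope.
Local Open Scope ring_scope.

(* The additive group Q/Z; [Num.int_num_subdef] is the predicate underlying
   [Num.int], and the one that carries the additive-subgroup structure. *)
Definition rat_mod_int : zmodType :=
  Quotient.quot (GRing.ZmodClosed.clone rat (@Num.int_num_subdef rat) _).

(* b = 0 is allowed, so singletons are arithmetic progressions. *)
Definition arithmetic_progression (P : set nat) : Prop :=
  exists a b : nat, P = [set (a + b * m)%N | m in [set: nat]].

(* |A `&` [0, n]| *)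
Definition initial_count (A : set nat) (n : nat) : nat :=
  #|[pred i : 'I_n.+1 | (i : nat) \in A]|.

(* [ln] is total, with value 0 on nonpositive reals; for each [m] this affects
   only finitely many [n], hence not the asymptotic condition. *)
Definition iterated_log (R : realType) (m : nat) (x : R) : R :=
  iter m (@ln R) x.

Definition very_sparse (R : realType) (A : set nat) : Prop :=
  forall m : nat, (0 < m)%N ->
    (fun n : nat => (initial_count A n)%:R : R)
      =o_\oo (fun n : nat => iterated_log m (n%:R : R)).

(* The real field [R] is used only to measure growth in [very_sparse]. *)
Definition almost_periodic (R : realType) (A : set nat) : Prop :=
  exists (F : set (set nat)) (S : set nat),
    [/\ finite_set F,
        forall P, F P -> arithmetic_progression P,
        very_sparse R S
      & A = (\bigcup_(P in F) P) `|` S].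

(* a_m x(n+m) + ... + a_1 x(n+1) + x(n) = 0 for all n, where the
   coefficient a_(i+1) is [a i]. *)
Definition satisfies_inverse_monic_recurrence
    (m : nat) (a : 'I_m -> int) (x : nat -> rat_mod_int) : Prop :=
  forall n : nat, \sum_(i < m) x (n + i.+1)%N *~ a i + x n = 0.

Definition inverse_monic_lrs (m : nat) (x : nat -> rat_mod_int) : Prop :=
  exists a : 'I_m -> int, satisfies_inverse_monic_recurrence a x.

(* Main.v *)
Require Import Defs.
From HB Require Import structures.
From mathcomp Require Import all_boot all_order all_algebra all_field.
From mathcomp Require Import all_classical all_reals all_analysis.
From mathcomp Require Import ring lra zify.

Set Implicit Arguments.
Unset Strict Implicit.
Unset Printing Implicit Defensive.

Import Order.TTheory GRing.Theory Num.Theory.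
Import numFieldNormedType.Exports.

Local Open Scope classical_set_scope.
Local Open Scope quotient_scope.
Local Open Scope ring_scope.

(** The idea is to lift the sequence [x] to rational sequences and to study the
    lifts one prime at a time, through a valuation of the algebraic numbers.

    Let [P = 1 + a_1 X + ... + a_m X^m].  For every [N] there is a sequence
    [u] of rationals, annihilated by [P], that agrees with [x] modulo [Z] on
    [0, N]; so [u n] is an integer whenever [x n = 0] and [n <= N].  Fix a
    prime [p] and a valuation ring [O] of the algebraic numbers above it.
    Since [P] has integer coefficients and constant term 1, all its roots
    have absolute value at least 1.  Roots of equal absolute value differ by a
    unit factor, and some power of that unit is congruent to 1 modulo any given
    power of [p]; restricting to residue classes modulo a suitable [Q], one may
    assume that the ratio itself is that close to 1.

    On a residue class, suppose that the zeros of [x] are clustered: arbitrarily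
    far out there are many of them in a window of exponential length.  Write
    [u] as the sum of its part [u1] for the roots as large as a largest root [b],
    of absolute value greater than 1, and the rest.  At a zero [n] of the cluster [u n] is integral and
    the rest is exponentially smaller than [b^n], hence [u1 n / b^n] is
    exponentially small in [n].  But [u1 n / b^n] is, as a function of [n], a
    power series to which Strassmann's argument applies ([strassmann]): small
    values at as many points as there are roots make it small everywhere, with a
    loss that is only logarithmic in the points.  So [u1] is bounded on a long
    initial segment, and one continues with the remaining roots, using a
    cluster in that initial segment; the roots of absolute value 1 only give
    bounded sequences.  This is [peel].  In the end the powers of [p] in
    the denominators of [x] are bounded on the class, and as only finitely many
    primes occur, [x] takes finitely many values there ([class_torsion]).
    The recurrence, run backwards, then acts on a finite set of states, so [x]
    is periodic on the class ([torsion_periodic]) and its zeros form finitely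
    many arithmetic progressions.

    If the zeros in a class are not clustered, their number up to [n] is at
    most a constant plus their number up to a multiple of [log n]; iterating,
    it is negligible against every iterated logarithm
    ([not_clustered_very_sparse]). *)

(** * Valuation rings *)

Record valuation_ring (K : fieldType) (O : set K) : Prop := ValuationRing {
  vring1 : O 1;
  vringB : forall x y, O x -> O y -> O (x - y);
  vringM : forall x y, O x -> O y -> O (x * y);
  vring_total : forall x, O x \/ O x^-1 }.

(** The maximal ideal. *)
Definition vmax (K : fieldType) (O : set K) : set K :=
  [set x | x = 0 \/ ~ O x^-1].

Section ValuationRing.
Variables (K : fieldType) (O : set K).
Hypothesis vO : valuation_ring O.
Local Notation M := (vmax O).
Let O1 := vring1 vO.
Let OB := vringB vO.

Lemma vring0 : O 0. Proof. by rewrite -(subrr 1); apply: OB. Qed.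

Lemma vringN x : O x -> O (- x).
Proof. by rewrite -sub0r; apply: OB vring0. Qed.

Lemma vringD x y : O x -> O y -> O (x + y).
Proof. by move=> Ox Oy; rewrite -[y]opprK; apply: OB (vringN Oy). Qed.

Lemma vringX x n : O x -> O (x ^+ n).
Proof. by move=> Ox; elim: n => [|n IHn]; rewrite ?exprS //; apply: vringM. Qed.

Lemma vring_nat n : O n%:R.
Proof. by elim: n => [|n IHn]; rewrite ?mulrS; [apply: vring0 | apply: vringD]. Qed.

Lemma vring_int (z : int) : O z%:~R.
Proof.
by case: z => n; rewrite ?NegzE ?mulrNz; [|apply: vringN]; apply: vring_nat.
Qed.

Lemma vring_sum (I : Type) (r : seq I) (P : pred I) (F : I -> K) :
  (forall i, P i -> O (F i)) -> O (\sum_(i <- r | P i) F i).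
Proof. by move=> OF; elim/big_ind: _ => //; [apply: vring0 | apply: vringD]. Qed.

Lemma vring_poly_coef_prod (I : Type) (r : seq I) (F : I -> {poly K}) :
  (forall i k, O (F i)`_k) -> forall k, O (\prod_(i <- r) F i)`_k.
Proof.
move=> OF; elim/big_ind: _ => [k|p q Op Oq k|//]; first by rewrite coef1; apply: vring_nat.
by rewrite coefM; apply: vring_sum => i _; apply: vringM.
Qed.

Lemma vmaxW x : M x -> O x.
Proof.
by case=> [->|nOx]; [apply: vring0 | case: (vring_total vO x)].
Qed.

Lemma vring_dichotomy x : M x \/ x != 0 /\ O x^-1.
Proof.
have [->|x0] := eqVneq x 0; first by left; left.
by have [Ox|nOx] := pselect (O x^-1); [right | left; right].
Qed.

Lemma vmax1 : ~ M 1.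
Proof. by case=> [/eqP|]; rewrite ?oner_eq0 // invr1. Qed.

Lemma vmaxV x : x != 0 -> M x -> ~ O x^-1.
Proof. by move=> /eqP x0 []. Qed.

Lemma vmaxMl x y : O x -> M y -> M (x * y).
Proof.
move=> Ox My; have [->|y0] := eqVneq y 0; first by rewrite mulr0; left.
have [->|x0] := eqVneq x 0; first by rewrite mul0r; left.
right=> Oxy; apply: vmaxV My _ => //.
suff -> : y^-1 = x * (x * y)^-1 by apply: vringM.
by rewrite invfM mulrA mulfV // mul1r.
Qed.

Lemma vmaxMr x y : M x -> O y -> M (x * y).
Proof. by rewrite mulrC => Mx Oy; apply: vmaxMl. Qed.

Lemma vmaxN x : M x -> M (- x).
Proof. by rewrite -mulN1r => Mx; apply: vmaxMl => //; apply: vringN. Qed.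

Lemma vmaxD x y : M x -> M y -> M (x + y).
Proof.
wlog Oxy : x y / O (x / y).
  move=> IH Mx My; case: (vring_total vO (x / y)) => [Oxy|]; first exact: IH.
  by rewrite invf_div addrC => Oxy; apply: IH.
move=> Mx My; have [y0|y0] := eqVneq y 0; first by rewrite y0 addr0.
have -> : x + y = (x / y + 1) * y by rewrite mulrDl divfK // mul1r.
by apply: vmaxMl My; apply: vringD.
Qed.

Lemma vmax_sum (I : Type) (r : seq I) (P : pred I) (F : I -> K) :
  (forall i, P i -> M (F i)) -> M (\sum_(i <- r | P i) F i).
Proof. by move=> MF; elim/big_ind: _ => //; [left | apply: vmaxD]. Qed.

Lemma vunitD x y : x != 0 -> O x^-1 -> M y -> x + y != 0 /\ O (x + y)^-1.
Proof.
move=> x0 Ox My; case: (vring_dichotomy (x + y)) => // Mxy.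
have Mx : M x by rewrite -(addrK y x); apply: vmaxD (vmaxN _).
by case: (vmaxV x0 Mx).
Qed.

End ValuationRing.

(** What the valuation ring of an extension of the [p]-adic valuation to an
    algebraic extension of the rationals satisfies: by [padic_bounded] and
    [padic_nilp] every valuation is comparable to a power of [p], so that no
    value group is needed to measure sizes; by [padic_unit] the residue
    field is algebraic over the field with [p] elements. *)
Record padic_ring (p : nat) (K : fieldType) (O : set K) : Prop := PadicRing {
  padic_vring :> valuation_ring O;
  padic_pN : ~ O p%:R^-1;
  padic_bounded : forall x, exists c, O (p%:R ^+ c * x);
  padic_nilp : forall x, vmax O x -> exists r, O (x ^+ r / p%:R);
  padic_unit : forall x, x != 0 -> O x -> O x^-1 ->
    exists2 N, (0 < N)%N & O ((x ^+ N - 1) / p%:R) }.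

(** * Existence of p-adic valuation rings *)

(** Throughout this section [A] is a subring maximal among those that do not
    contain [1/p]. *)
Section Maximal.
Variables (p : nat) (K : fieldType) (A : set K).
Hypotheses (A1 : A 1) (AB : forall x y, A x -> A y -> A (x - y))
  (AM : forall x y, A x -> A y -> A (x * y)) (ApN : ~ A p%:R^-1).
Hypothesis Amax : forall B : set K, A `<=` B -> B 1 ->
  (forall x y, B x -> B y -> B (x - y)) ->
  (forall x y, B x -> B y -> B (x * y)) -> ~ B p%:R^-1 -> B `<=` A.

Let A0 : A 0. Proof. by rewrite -(subrr 1); apply: AB. Qed.
Let AN x : A x -> A (- x).
Proof. by rewrite -sub0r; apply: AB A0. Qed.
Let AD x y : A x -> A y -> A (x + y).
Proof. by move=> Ax Ay; rewrite -[y]opprK; apply: AB (AN Ay). Qed.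
Let An n : A n%:R.
Proof. by elim: n => [|n IHn]; rewrite ?mulrS //; apply: AD. Qed.
Let Asum (I : Type) (r : seq I) (P : pred I) (F : I -> K) :
  (forall i, P i -> A (F i)) -> A (\sum_(i <- r | P i) F i).
Proof. by move=> AF; elim/big_ind: _. Qed.
Let p0 : p%:R != 0 :> K.
Proof. by apply/eqP => p0; apply: ApN; rewrite p0 invr0. Qed.
Let pV (c : K) : p%:R * c = 1 -> p%:R^-1 = c.
Proof. by move=> e; apply: (mulfI p0); rewrite mulfV. Qed.
Let AX x n : A x -> A (x ^+ n).
Proof. by move=> Ax; elim: n => [|n IHn]; rewrite ?exprS //; apply: AM. Qed.

(** Inverting [1 - p b] cannot produce [1/p], because [(1 - p b)^k] is
    congruent to 1 modulo [p]; so maximality puts the inverse in [A]. *)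
Lemma maximal_unit b : A b -> 1 - p%:R * b != 0 /\ A (1 - p%:R * b)^-1.
Proof.
move=> Ab; set u := 1 - _.
have Au : A u by apply: AB => //; apply: AM => //; apply: An.
have u0 : u != 0.
  apply/eqP => /eqP; rewrite subr_eq0 => /eqP e; apply: ApN.
  by rewrite (pV (esym e)).
split=> //; pose B := [set x : K | exists k, A (x * u ^+ k)].
apply: (Amax (B := B)) => [x Ax||x y [k xk] [l yl]|x y [k xk] [l yl]|[k]|].
- by exists 0%N; rewrite mulr1.
- by exists 0%N; rewrite mulr1.
- exists (k + l)%N; rewrite mulrBl; apply: AB.
    by rewrite exprD mulrA; apply: AM => //; apply: AX.
  by rewrite addnC exprD mulrA; apply: AM => //; apply: AX.
- exists (k + l)%N; rewrite exprD mulrACA; exact: AM.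
- move=> H; apply: ApN.
  have [c Ac e] : exists2 c, A c & u ^+ k = 1 - p%:R * c.
    elim: k {H} => [|k [c Ac IH]]; first by exists 0; rewrite // mulr0 subr0.
    exists (b + c - p%:R * b * c).
      by apply: AB; [apply: AD | apply: AM => //; apply: AM => //; apply: An].
    by rewrite exprS IH /u; ring.
  move: H; rewrite e mulrBr mulr1 mulKf // => /AD/(_ Ac).
  by rewrite subrK.
- by exists 1%N; rewrite mulVf.
Qed.

Lemma maximal_adjoin x : ~ A x ->
  exists2 q : {poly K}, (forall i, A q`_i) & p%:R * q.[x] = 1.
Proof.
move=> nAx.
pose B := [set y : K | exists2 q : {poly K}, (forall i, A q`_i) & y = q.[x]].
have [[q Aq e]|nB] := pselect (B p%:R^-1).
  by exists q => //; rewrite -e mulfV.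
have AXp i : A ('X : {poly K})`_i by rewrite coefX; apply: An.
case: nAx; apply: (Amax (B := B)) => //.
- move=> a Aa; exists a%:P; rewrite ?hornerC // => i.
  by rewrite coefC; case: ifP.
- exists 1; rewrite ?hornerC // => i; rewrite coef1; exact: An.
- move=> _ _ [q Aq ->] [r Ar ->]; exists (q - r); rewrite ?hornerE // => i.
  by rewrite coefB; apply: AB.
- move=> _ _ [q Aq ->] [r Ar ->]; exists (q * r); rewrite ?hornerM // => i.
  by rewrite coefM; apply: Asum => j _; apply: AM.
- by exists 'X; rewrite ?hornerX.
Qed.

(** Chevalley's descent: if both [x] and its inverse produce [1/p], the relation
    in the inverse expresses the top power of [x] in the other relation through
    lower ones, its constant term [1 - p r_0] being a unit; the degrees
    decrease until [1/p] itself lies in [A]. *)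
Lemma maximal_descent n (q r : {poly K}) (x : K) : x != 0 ->
  (size q + size r <= n)%N -> (forall i, A q`_i) -> (forall i, A r`_i) ->
  p%:R * q.[x] = 1 -> p%:R * r.[x^-1] = 1 -> False.
Proof.
elim: n q r x => [|n IHn] q r x x0.
  rewrite leqn0 addn_eq0 size_poly_eq0 => /andP[/eqP-> _] _ _.
  by rewrite horner0 mulr0 => /eqP; rewrite eq_sym oner_eq0.
wlog le_rq : q r x x0 / (size r <= size q)%N.
  move=> H; case/orP: (leq_total (size r) (size q)) => le; first exact: H.
  move=> sz Aq Ar eq er; apply: (H r q x^-1) => //; rewrite ?invr_eq0 //.
    by rewrite addnC.
  by rewrite invrK.
move=> sz Aq Ar eq er.
have [u0 Au] := maximal_unit (Ar 0).
pose u := 1 - p%:R * r`_0.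
have [r' Ar' er'] : exists2 r' : {poly K}, (forall i, A r'`_i)
    & (size r' <= (size r).-1)%N /\ r = (r`_0)%:P + r' * 'X.
  exists (\poly_(i < (size r).-1) r`_i.+1) => [i|].
    by rewrite coef_poly; case: ifP.
  split; first exact: size_poly.
  apply/polyP => -[|i]; rewrite coefD coefC coefMX /= ?addr0 // add0r coef_poly.
  by case: ltnP => // le; rewrite nth_default //; move: le; lia.
case: er' => szr' er'.
have rel : p%:R / u * (x^-1 * r'.[x^-1]) = 1.
  rewrite mulrAC; apply: (canLR (mulfK u0)); rewrite mul1r.
  move: er; rewrite {1}er' hornerD hornerC hornerM hornerX mulrDr => e.
  by rewrite -[X in X - _]e; ring.
case Es: (size q) le_rq sz => [|m] le_rq sz.
  move: eq; move/eqP: Es; rewrite size_poly_eq0 => /eqP ->.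
  by rewrite horner0 mulr0 => /eqP; rewrite eq_sym oner_eq0.
case: m Es le_rq sz => [|m] Es le_rq sz.
  have szq : (size q <= 1)%N by rewrite Es.
  move: eq; rewrite (size1_polyC szq) hornerC => eq; apply: ApN.
  by rewrite (pV eq).
pose a := q`_m.+1 * (p%:R / u).
pose s := \poly_(i < m.+1) (q`_i + a * r'`_(m - i)).
have Aa : A a by rewrite /a; apply: AM => //; apply: AM => //; apply: An.
apply: (IHn s r x) => //.
- by rewrite -ltnS (leq_trans _ sz) // ltn_add2r ltnS size_poly.
- move=> i; rewrite coef_poly; case: ifP => // _; apply: AD => //.
  exact: AM.
rewrite -[RHS]eq; congr (_ * _); rewrite horner_poly horner_coef Es [RHS]big_ord_recr /=.
under eq_bigr => i _ do rewrite mulrDl.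
rewrite big_split /=; congr (_ + _).
rewrite -[RHS]mulr1 -[X in _ = _ * X]rel [RHS](_ : _ = a * (x ^+ m * r'.[x^-1])); last first.
  by rewrite /a exprSr; field; rewrite x0 andbT; exact: u0.
rewrite (@horner_coef_wide _ m.+1); last first.
  by move: szr' le_rq; lia.
rewrite !mulr_sumr (reindex_inj rev_ord_inj) /=; apply: eq_bigr => i _.
have le : (i <= m)%N by rewrite -ltnS.
rewrite subSS subKn // -mulrA; congr (_ * _); rewrite mulrCA exprVn; congr (_ * _).
have -> : x ^+ m = x ^+ (m - i) * x ^+ i by rewrite -exprD subnK.
by rewrite mulfK ?expf_neq0.
Qed.

Lemma maximal_valuation_ring : valuation_ring A.
Proof.
split=> // x; have [Ax|/maximal_adjoin[q Aq eq]] := pselect (A x); [by left|right].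
have [Ax|/maximal_adjoin[r Ar er]] := pselect (A x^-1); first by [].
have [x0|x0] := eqVneq x 0; first by rewrite x0 invr0.
by case: (maximal_descent x0 (leqnn _) Aq Ar eq er).
Qed.

(** If [1/p] is a polynomial in the inverse of [x], multiplying by a high power
    of [x] clears the denominators: some power of [x] is divisible by [p]. *)
Lemma maximal_nilp x : vmax A x -> exists r, A (x ^+ r / p%:R).
Proof.
case=> [->|]; first by exists 1%N; rewrite expr1 mul0r.
have [->|x0] := eqVneq x 0; first by rewrite invr0.
move=> /maximal_adjoin[q Aq eq]; exists (size q).
have Ax : A x.
  have := vring_total maximal_valuation_ring x.
  case=> // Ax; suff : A p%:R^-1 by [].
  by rewrite (pV eq) horner_coef; apply: Asum => i _; apply: AM => //; apply: AX.
rewrite (pV eq) horner_coef mulr_sumr; apply: Asum => i _; rewrite mulrCA; apply: AM => //.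
have le : (i <= size q)%N by apply: ltnW.
have -> : x ^+ size q = x ^+ (size q - i) * x ^+ i by rewrite -exprD subnK.
by rewrite exprVn mulfK ?expf_neq0 //; apply: AX.
Qed.

End Maximal.

Lemma pigeonhole (T : finType) (f : nat -> T) n :
  exists i j, [/\ (n <= i)%N, (i < j)%N, (j <= n + #|T|)%N & f i = f j].
Proof.
apply: contrapT => H; have inj : injective (fun i : 'I_#|T|.+1 => f (n + i)%N).
  move=> i j e; apply: val_inj => /=; case: (ltngtP i j) => // lt; case: H.
    by exists (n + i)%N, (n + j)%N; split=> //; have := ltn_ord j; lia.
  by exists (n + j)%N, (n + i)%N; split=> //; have := ltn_ord i; lia.
by have := leq_card _ inj; rewrite card_ord ltnn.
Qed.

(** * Algebraic numbers in a p-adic valuation ring *)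
Section Padic.
Variables (p : nat) (K : numFieldType) (O : set K).
Hypotheses (p_pr : prime p) (vO : valuation_ring O) (OpN : ~ O p%:R^-1).

Lemma pnat_neq0 : p%:R != 0 :> K.
Proof. by rewrite pnatr_eq0 -lt0n prime_gt0. Qed.

Lemma vmax_p : vmax O p%:R.
Proof. by right. Qed.

Lemma vring_coprime_int (c : int) : ~~ (p %| c)%Z -> O (c%:~R)^-1.
Proof.
move=> pc; case: (vring_dichotomy O c%:~R) => [Mc|[]//].
have [u [v e]] := Bezoutz c p.
case: (vmax1 vO); rewrite -[1]/(1%:~R).
have <- : gcdz c p = 1.
  apply/eqP; rewrite eqz_nat.
  by move: pc; rewrite -prime_coprime ?(coprime_sym _ p) //; rewrite /coprime gcdnC.
rewrite -e rmorphD !rmorphM /=; apply: vmaxD => //; apply: vmaxMl => //; try exact: vring_int.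
exact: vmax_p.
Qed.

Lemma vring_coprime_nat (c : nat) : coprime p c -> O (c%:R)^-1.
Proof. by rewrite prime_coprime // => pc; apply: (@vring_coprime_int c). Qed.

Lemma vring_logn (c : nat) : (0 < c)%N -> O (p%:R ^+ logn p c / c%:R).
Proof.
move=> c0; have [m pm {2}->] := pfactor_coprime p_pr c0.
rewrite natrM natrX invfM mulrCA mulfV ?expf_neq0 ?pnat_neq0 // mulr1.
exact: vring_coprime_nat.
Qed.

Hypothesis K_alg : forall x : K,
  exists2 q : {poly int}, q != 0 & root (map_poly intr q) x.

Lemma algebraic_primitive (x : K) :
  exists2 q : {poly int}, zcontents q = 1 & root (map_poly intr q) x.
Proof.
have [q q0 qx] := K_alg x; exists (zprimitive q).
  by rewrite zcontents_primitive q0.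
move: qx; rewrite {1}[q]zpolyEprim map_polyZ rootZ //=.
by rewrite intr_eq0 zcontents_eq0.
Qed.

(** The leading coefficient [c] of an integral equation of [x] satisfies
    [c x] in [O]: divide the equation by a power of [x].  Only the power of
    [p] in [c] matters, the rest being a unit. *)
Lemma algebraic_bounded (x : K) : exists c, O (p%:R ^+ c * x).
Proof.
case: (vring_total vO x) => [Ox|Oy]; first by exists 0%N; rewrite mul1r.
have [x0|x0] := eqVneq x 0; first by exists 0%N; rewrite mul1r x0; apply: vring0.
have [q q0 /rootP qx] := K_alg x.
pose c := lead_coef q; have c0 : c != 0 by rewrite lead_coef_eq0.
have Oc : O (c%:~R * x).
  have sq : (0 < size q)%N by rewrite lt0n size_poly_eq0.
  case Es: (size q) sq => [//|n] _.
  have lc : (map_poly intr q)`_n = c%:~R :> K by rewrite coef_map /= /c lead_coefE Es.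
  have sm : (size (map_poly intr q : {poly K}) <= n.+1)%N.
    by rewrite -Es; apply: size_poly.
  move: qx; rewrite (horner_coef_wide _ sm) big_ord_recr /= lc.
  move=> /eqP; rewrite addrC addr_eq0 => /eqP e.
  have -> : c%:~R * x = c%:~R * x ^+ n * (x / x ^+ n).
    by field; rewrite expf_neq0.
  rewrite e mulNr.
  apply: (vringN vO); rewrite mulr_suml; apply: (vring_sum vO) => i _.
  rewrite coef_map /= -mulrA; apply: (vringM vO); first exact: (vring_int vO).
  have -> : x ^+ n = x ^+ (n - i.+1) * x ^+ i * x.
    by rewrite -mulrA -exprSr -exprD subnK.
  rewrite [X in O X](_ : _ = x^-1 ^+ (n - i.+1)); first exact: vringX.
  by rewrite exprVn; field; rewrite x0 !expf_neq0.
have cn0 : (0 < `|c|)%N by rewrite absz_gt0.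
exists (logn p `|c|); rewrite -[x](mulKf (x := `|c|%:R)) ?pnatr_eq0 -?lt0n //.
rewrite mulrA; apply: (vringM vO); first exact: vring_logn.
case: (c) Oc => n; rewrite ?NegzE // mulrNz mulNr => /(vringN vO).
by rewrite opprK.
Qed.

(** Modulo [p], the powers of [x] are represented by the powers of the variable
    in the finite ring of polynomials over the prime field modulo the reduction
    of an equation of [x], which is nonzero for a primitive equation.  Two of
    them coincide. *)
Lemma algebraic_unit (x : K) : x != 0 -> O x -> O x^-1 ->
  exists2 N, (0 < N)%N & O ((x ^+ N - 1) / p%:R).
Proof.
move=> x0 Ox OVx; have [q q1 qx] := algebraic_primitive x.
pose red := map_poly (intr : int -> 'F_p).
have red_eq0 (F : {poly int}) : red F = 0 -> O ((map_poly intr F).[x] / p%:R).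
  move=> F0; rewrite horner_coef mulr_suml; apply: (vring_sum vO) => i _.
  have : (p %| F`_i)%Z.
    by rewrite (dvdz_pcharf (pchar_Fp p_pr)) -coef_map -/(red F) F0 coef0.
  case/dvdzP => k; rewrite coef_map /= => ->; rewrite rmorphM /=.
  rewrite -[p%:~R]/(p%:R : K) mulrAC mulfK ?pnat_neq0 //.
  by apply: (vringM vO); [apply: vring_int | apply: vringX].
have rq0 : red q != 0.
  apply/eqP => rq0; have : (p %| zcontents q)%Z.
    rewrite dvdz_contents; apply/polyOverP => i.
    rewrite -[_ \in _]/((p %| q`_i)%Z).
    by rewrite (dvdz_pcharf (pchar_Fp p_pr)) -coef_map -/(red q) rq0 coef0.
  by rewrite q1 dvdz1 => /eqP; have := prime_gt1 p_pr; lia.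
pose f n : {ffun 'I_(size (red q)) -> 'F_p} := [ffun i : 'I__ => ('X^n %% red q)`_i].
have [a [b [_ ab _ fab]]] := pigeonhole f 0.
have /eqP eab : 'X^a %% red q = 'X^b %% red q.
  apply/polyP => i; case: (ltnP i (size (red q))) => [lt|le].
    by have /ffunP/(_ (Ordinal lt)) := fab; rewrite !ffunE.
  by rewrite !nth_default // (leq_trans _ le) // ltnW // ltn_modp.
have [h eh] : exists h, 'X^b - 'X^a = h * red q.
  by apply/dvdpP; rewrite /dvdp modpD modpN (eqP eab) subrr.
pose H := \poly_(i < size h) (Posz (nat_of_ord (h`_i : 'F_p))).
have redH : red H = h.
  apply/polyP => i; rewrite coef_map coef_poly /=; case: ltnP => le.
    by rewrite -[LHS]/((nat_of_ord (h`_i : 'F_p))%:R) natr_Zp.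
  by rewrite nth_default.
have /red_eq0 : red ('X^b - 'X^a - H * q) = 0.
  by rewrite /red !rmorphB rmorphM /= !map_polyXn -/(red q) -/(red H) redH -eh subrr.
rewrite !rmorphB rmorphM /= !map_polyXn !hornerE (rootP qx) mulr0 subr0 => Oab.
exists (b - a)%N; first by rewrite subn_gt0.
rewrite [X in O X](_ : _ = x^-1 ^+ a * ((x ^+ b - x ^+ a) / p%:R)).
  by apply: (vringM vO) => //; apply: vringX.
have -> : x ^+ b = x ^+ (b - a) * x ^+ a by rewrite -exprD subnK // ltnW.
by rewrite exprVn; field; rewrite pnat_neq0 expf_neq0.
Qed.

End Padic.

(** Zorn's lemma provides a subring maximal among those avoiding [1/p]. *)
Lemma exists_padic_ring (p : nat) (K : numFieldType) : prime p ->
  (forall x : K, exists2 q : {poly int}, q != 0 & root (map_poly intr q) x) ->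
  exists O : set K, padic_ring p O.
Proof.
move=> p_pr K_alg.
pose P (A : set K) := [/\ A !=set0 -> A 1, forall x y, A x -> A y -> A (x - y),
  forall x y, A x -> A y -> A (x * y) & ~ A p%:R^-1].
(* The empty set is admitted because the empty chain has empty union. *)
have [A [[A1 AB AM ApN] Amax]] : exists A, P A /\ forall B, A `<` B -> ~ P B.
  apply: Zorn_bigcup => F FP Ftot.
  have pair x y : (\bigcup_(X in F) X) x -> (\bigcup_(X in F) X) y ->
      exists X, [/\ F X, X x & X y].
    move=> [X FX Xx] [Y FY Yy]; case: (Ftot _ _ FX FY) => sub.
      by exists Y; split=> //; apply: sub.
    by exists X; split=> //; apply: sub.
  split.
  - move=> [x [X FX Xx]]; exists X => //; have [X1 _ _ _] := FP _ FX.
    by apply: X1; exists x.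
  - move=> x y Ux Uy; have [X [FX Xx Xy]] := pair _ _ Ux Uy.
    by exists X => //; have [_ XB _ _] := FP _ FX; apply: XB.
  - move=> x y Ux Uy; have [X [FX Xx Xy]] := pair _ _ Ux Uy.
    by exists X => //; have [_ _ XM _] := FP _ FX; apply: XM.
  - by move=> [X FX Xp]; have [_ _ _ XN] := FP _ FX; apply: XN.
have {}A1 : A 1.
  have [[x Ax]|A0] := pselect (A !=set0); first by apply: A1; exists x.
  pose Z := [set x : K | exists c : int, x = c%:~R].
  exfalso; apply: (Amax Z); first split.
  - by move=> x Ax; case: A0; exists x.
  - by move=> /(_ 1) H; apply: A0; exists 1; apply: H; exists 1.
  split=> [_|_ _ [c ->] [d ->]|_ _ [c ->] [d ->]|[c /(congr1 (fun x => x * p%:R))]].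
  - by exists 1.
  - by exists (c - d); rewrite rmorphB.
  - by exists (c * d); rewrite rmorphM.
  - rewrite mulVf ?pnat_neq0 // -[p%:R]/(p%:~R) -rmorphM -[1]/(1%:~R).
    move=> /eqP; rewrite eqr_int => /eqP/esym/(congr1 absz).
    by rewrite abszM => /eqP; rewrite muln_eq1 => /andP[_ /eqP]; have := prime_gt1 p_pr; lia.
have {}Amax (B : set K) : A `<=` B -> B 1 ->
    (forall x y, B x -> B y -> B (x - y)) ->
    (forall x y, B x -> B y -> B (x * y)) -> ~ B p%:R^-1 -> B `<=` A.
  move=> AsubB B1 BB BM BpN; apply: contrapT => BA.
  by apply: (Amax B).
have vA := maximal_valuation_ring A1 AB AM ApN Amax.
exists A; split=> //.
- exact: algebraic_bounded.
- by move=> x; apply: maximal_nilp.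
- exact: algebraic_unit.
Qed.

Lemma algC_algebraic (x : algC) :
  exists2 q : {poly int}, q != 0 & root (map_poly intr q) x.
Proof.
have [q [e mq] _] := minCpolyP x; have [r [a a0 er]] := rat_poly_scale q.
exists r.
  apply/eqP => r0; move: (monic_neq0 mq).
  by rewrite er r0 map_poly0 scaler0 eqxx.
have := root_minCpoly x; rewrite e er map_polyZ rootZ /=; last first.
  by rewrite fmorph_eq0 invr_eq0 intr_eq0.
rewrite -map_poly_comp (eq_map_poly (g := intr)) // => z /=.
exact: ratr_int.
Qed.

(** * Polynomials in the shift *)

(** The linear functional on polynomials that maps ['X^i] to [u i].  Applying
    the polynomial [P] in the shift operator to [u] gives the sequence
    [appl u ('X^n * P)]. *)
Definition appl (K : fieldType) (u : nat -> K) (P : {poly K}) : K :=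
  \sum_(i < size P) P`_i * u i.

Section Appl.
Variable K : fieldType.
Implicit Types (u v : nat -> K) (P Q F : {poly K}).

Lemma appl_wide u P n : (size P <= n)%N -> appl u P = \sum_(i < n) P`_i * u i.
Proof.
move=> le; rewrite /appl (big_ord_widen _ (fun i => P`_i * u i) le) big_mkcond /=.
by apply: eq_bigr => i _; case: ltnP => // ge; rewrite nth_default ?mul0r.
Qed.

Lemma appl_is_linear u : GRing.linear_for *%R (appl u).
Proof.
move=> c P Q; pose n := maxn (size P) (size Q).
have le : (size (c *: P + Q)%R <= n)%N.
  rewrite (leq_trans (size_polyD _ _)) // geq_max leq_maxr andbT.
  exact: leq_trans (size_scale_leq _ _) (leq_maxl _ _).
rewrite (appl_wide _ le) (appl_wide _ (leq_maxl _ _ : (size P <= n)%N)).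
rewrite (appl_wide _ (leq_maxr _ _ : (size Q <= n)%N)) mulr_sumr -big_split /=.
by apply: eq_bigr => i _; rewrite coefD coefZ mulrDl mulrA.
Qed.

HB.instance Definition _ u :=
  GRing.isLinear.Build K {poly K} K *%R (appl u) (appl_is_linear u).

Lemma applXn u n : appl u 'X^n = u n.
Proof.
rewrite /appl size_polyXn big_ord_recr /= coefXn eqxx mul1r big1 ?add0r // => i _.
by rewrite coefXn ltn_eqF ?mul0r.
Qed.

Lemma applZ_seq u c P : appl (fun n => c * u n) P = c * appl u P.
Proof. by rewrite /appl mulr_sumr; apply: eq_bigr => i _; rewrite mulrCA. Qed.

(** Sequences of the form [appl u (H * Y ^+ n)] cover the operations needed
    below: applying a polynomial [H] in the shift ([Y = 'X]), passing to a
    residue class ([Y = 'X^Q]), dividing by [b ^+ n] ([Y = b^-1 *: 'X]) and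
    finite differences at 0 ([Y = 'X - 1]). *)
Lemma appl_comp u H Y F :
  appl (fun n => appl u (H * Y ^+ n)) F = appl u (H * (F \Po Y)).
Proof.
rewrite comp_polyE mulr_sumr linear_sum; apply: eq_bigr => i _.
by rewrite -scalerAr linearZ.
Qed.

(** The recurrence with characteristic polynomial [P], stated for all multiples
    of [P] so that it passes to every polynomial that [P] divides. *)
Definition annih u P := forall F, appl u (F * P) = 0.

Lemma annihP u P : (forall n, appl u ('X^n * P) = 0) -> annih u P.
Proof.
move=> uP F; rewrite -[F]coefK poly_def mulr_suml linear_sum big1 // => i _.
by rewrite -scalerAl linearZ /= uP mulr0.
Qed.

Lemma annih_dvd u P Q : annih u P -> P %| Q -> annih u Q.
Proof. by move=> uP /dvdpP[F ->] G; rewrite mulrA. Qed.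

Lemma annih1 u n : annih u 1 -> u n = 0.
Proof. by move=> /(_ 'X^n); rewrite mulr1 applXn. Qed.

Lemma annihZ u c P : annih u P -> annih (fun n => c * u n) P.
Proof. by move=> uP F; rewrite applZ_seq uP mulr0. Qed.

Lemma annihM u H P Q :
  annih u P -> P %| H * Q -> annih (fun n => appl u (H * 'X^n)) Q.
Proof.
move=> uP dvd F; rewrite appl_comp comp_polyXr mulrCA.
by have /dvdpP[G ->] := dvd; rewrite mulrA uP.
Qed.

Definition root_poly (s : seq K) : {poly K} := \prod_(a <- s) ('X - a%:P).

(** Substituting [Y] for the shift replaces each characteristic root [a] by
    [Y.[a]]. *)
Lemma annih_map u s Y H :
  annih u (root_poly s) ->
  annih (fun n => appl u (H * Y ^+ n)) (root_poly [seq Y.[a] | a <- s]).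
Proof.
move=> uP F; rewrite appl_comp comp_polyM mulrA.
have /dvdpP[G ->] : root_poly s %| root_poly [seq Y.[a] | a <- s] \Po Y.
  rewrite /root_poly big_map; elim: s {uP} => [|a s IHs]; first by rewrite !big_nil dvd1p.
  rewrite !big_cons comp_polyM; apply: dvdp_mul IHs.
  by rewrite comp_polyB comp_polyX comp_polyC dvdp_XsubCl /root !hornerE subrr.
by rewrite mulrA uP.
Qed.

End Appl.

Section Bounds.
Variables (K : fieldType) (O : set K).
Hypothesis vO : valuation_ring O.

(** Induction on the roots: [u (n+1) - a * u n] satisfies the recurrence
    without the root [a], and [u] is recovered from it by integral operations. *)
Lemma bounded_recurrence (s : seq K) (u : nat -> K) :
  (forall a, a \in s -> O a) -> annih u (root_poly s) ->
  (forall k, (k < size s)%N -> O (u k)) -> forall k, O (u k).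
Proof.
elim: s u => [|a s IHs] u Os us Ou k.
  by rewrite annih1; [apply: vring0 | move: us; rewrite /root_poly big_nil].
pose v n := appl u (('X - a%:P) * 'X^n).
have vE n : v n = u n.+1 - a * u n.
  by rewrite /v mulrBl -exprS linearB /= mul_polyC linearZ /= !applXn.
have Oa : O a by apply: Os; rewrite mem_head.
have Ov : forall k, O (v k).
  apply: IHs => [b bs||n lt]; first by apply: Os; rewrite in_cons bs orbT.
    by apply: annihM us _; rewrite /root_poly big_cons.
  rewrite vE; apply: (vringB vO); first exact: Ou.
  by apply: (vringM vO) => //; apply: Ou; rewrite /= ltnW.
elim: k => [|k IHk]; first by apply: Ou.
by rewrite -(subrK (a * u k) (u _)) -vE; apply: (vringD vO) => //; apply: (vringM vO).
Qed.

(** Division by [b ^+ n] divides the roots by [b] and so makes them integral. *)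
Lemma growth_bound (s : seq K) (u : nat -> K) (b c : K) : b != 0 ->
  (forall a, a \in s -> O (a / b)) -> annih u (root_poly s) ->
  (forall k, (k < size s)%N -> O (c * u k / b ^+ k)) ->
  forall k, O (c * u k / b ^+ k).
Proof.
move=> b0 Os us Ou.
pose w n := c * appl u (1 * (b^-1 *: 'X) ^+ n).
have wE n : w n = c * u n / b ^+ n.
  by rewrite /w mul1r exprZn linearZ /= applXn exprVn; ring.
move=> k; rewrite -wE.
apply: (@bounded_recurrence [seq (b^-1 *: 'X : {poly K}).[a] | a <- s]).
- by move=> _ /mapP[a sa ->]; rewrite !hornerE mulrC; apply: Os.
- by apply: annihZ; apply: annih_map.
- by move=> n; rewrite size_map wE; apply: Ou.
Qed.

(** Absolute values are compared through explicit factors, so that zero values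
    are allowed; choosing the last of the largest values makes the later ones
    strictly smaller. *)
Lemma last_largest (c : nat -> K) e : exists2 k0, (k0 <= e)%N &
  (forall k, (k <= e)%N -> exists2 a, O a & c k = c k0 * a) /\
  (forall k, (k0 < k <= e)%N -> exists2 a, vmax O a & c k = c k0 * a).
Proof.
elim: e => [|e [k0 le [IH1 IH2]]].
  exists 0%N => //; split=> k; last by case: k.
  by rewrite leqn0 => /eqP ->; exists 1; [apply: vring1 | rewrite mulr1].
have [[a Ma ea]|nM] := pselect (exists2 a, vmax O a & c e.+1 = c k0 * a).
  exists k0; first exact: leqW.
  split=> k.
    rewrite leq_eqVlt ltnS.
    by case/orP=> [/eqP->|]; [exists a => //; apply: vmaxW | apply: IH1].
  case/andP=> lt; rewrite leq_eqVlt ltnS.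
  by case/orP=> [/eqP->|ke]; [exists a | apply: IH2; rewrite lt].
have [a Oa ea] : exists2 a, O a & c k0 = c e.+1 * a.
  have [c0|c0] := eqVneq (c k0) 0; first by exists 0; [apply: vring0 | rewrite mulr0].
  case: (vring_dichotomy O (c e.+1 / c k0)) => [M1|[r0 Or]].
    by case: nM; exists (c e.+1 / c k0); rewrite // mulrCA mulfV ?mulr1.
  exists (c e.+1 / c k0)^-1 => //; rewrite invf_div mulrCA mulfV ?mulr1 //.
  by apply: contraNneq r0 => ->; rewrite mul0r.
exists e.+1 => //; split=> k; last by case: ltngtP.
  rewrite leq_eqVlt ltnS; case/orP=> [/eqP->|/IH1[b Ob ->]].
    by exists 1; [apply: vring1 | rewrite mulr1].
  by exists (a * b); [apply: (vringM vO) | rewrite ea mulrA].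
Qed.

End Bounds.

Lemma logn_fact_lt p n : prime p -> (0 < n)%N -> (logn p n`! < n)%N.
Proof.
move=> p_pr n0; rewrite logn_fact //.
have H m : forall k, (0 < k)%N -> (\sum_(1 <= i < m.+1) k %/ p ^ i < k)%N.
  elim: m => [|m IHm] k k0; first by rewrite big_nil.
  have pk : (k %/ p * p <= k)%N := leq_trunc_div _ _.
  have p1 := prime_gt1 p_pr.
  rewrite big_nat_recl //= expn1.
  have -> : (\sum_(1 <= i < m.+1) k %/ p ^ i.+1 = \sum_(1 <= i < m.+1) k %/ p %/ p ^ i)%N.
    by apply: eq_bigr => i _; rewrite expnS divnMA.
  case: (posnP (k %/ p)%N) => [->|lt].
    by rewrite big1 // => i _; rewrite div0n.
  by have := IHm _ lt; nia.
exact: H.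
Qed.

(** * Sequences whose characteristic roots are close to 1 *)
Section Strassmann.
Variables (p : nat) (K : numFieldType) (O : set K).
Hypotheses (p_pr : prime p) (pO : padic_ring p O).
Local Notation M := (vmax O).
Let vO : valuation_ring O := pO.
Let OpN := padic_pN pO.
Let p0 : p%:R != 0 :> K := pnat_neq0 K p_pr.

Lemma vring_diff D (i j : nat) : (i < p ^ D)%N -> (j < p ^ D)%N -> i != j ->
  O (p%:R ^+ D / (i%:R - j%:R)).
Proof.
wlog lt : i j / (j < i)%N.
  move=> H iD jD; rewrite neq_ltn => /orP[] lt.
    rewrite -opprB invrN mulrN; apply: (vringN vO).
    by apply: H; rewrite // neq_ltn lt ?orbT.
  by apply: H; rewrite // neq_ltn lt ?orbT.
move=> iD jD ij; rewrite -natrB 1?ltnW //.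
have d0 : (0 < i - j)%N by rewrite subn_gt0.
have le : (logn p (i - j) <= D)%N.
  rewrite -(leq_exp2l _ _ (prime_gt1 p_pr)).
  have := dvdn_leq d0 (pfactor_dvdnn p (i - j)); lia.
rewrite -(subnK le) exprD -mulrA; apply: (vringM vO).
  by apply: (vringX vO); apply: (vring_nat vO).
exact: vring_logn.
Qed.

(** Modulo the maximal ideal, [V] has degree exactly [j].  Dividing [V - V(n0)]
    by ['X - n0] lowers the degree by one and costs a division by [n - n0], that
    is at most [p ^ D]; so small values at [j + 1] points would leave a
    small value of a polynomial that is constant and a unit modulo the maximal
    ideal. *)
Lemma dominated_values D j (V : {poly K}) (l : seq nat) :
  (forall k, O V`_k) -> (forall k, (j < k)%N -> M V`_k) ->
  V`_j != 0 -> O (V`_j)^-1 ->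
  uniq l -> size l = j.+1 -> (forall n, n \in l -> (n < p ^ D)%N) ->
  exists2 n, n \in l & ~ exists2 a, M a & V.[n%:R] = p%:R ^+ (D * j) * a.
Proof.
elim: j V l => [|j IHj] V [//|n0 l] OV MV V0 OVj ul sl lD.
  exists n0; rewrite ?mem_head // => -[a Ma].
  rewrite muln0 mul1r => e; move: Ma; rewrite -e {e} horner_coef.
  case Es: (size V) => [|n].
    by move/eqP: Es V0; rewrite size_poly_eq0 => /eqP ->; rewrite coef0 eqxx.
  rewrite big_ord_recl mulr1 /= => MV0.
  have MS : M (\sum_(i < n) V`_(bump 0 i) * n0%:R ^+ bump 0 i).
    apply: (vmax_sum vO) => i _; apply: (vmaxMr vO); first exact: MV.
    by apply: (vringX vO); apply: (vring_nat vO).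
  have := vmaxD vO MV0 (vmaxN vO MS); rewrite addrK => /(vmaxV V0); exact.
apply: contrapT => H.
have {H}HV n : n \in n0 :: l -> exists2 a, M a & V.[n%:R] = p%:R ^+ (D * j.+1) * a.
  by move=> nl; apply: contrapT => nV; apply: H; exists n.
have [W eW] : exists W, V - V.[n0%:R]%:P = W * ('X - n0%:R%:P).
  by apply/factor_theorem; rewrite /root !hornerE subrr.
have coefW k : W`_k = V`_k.+1 + n0%:R * W`_k.+1.
  have := congr1 (fun q : {poly K} => q`_k.+1) eW.
  by rewrite coefB coefC /= subr0 mulrBr coefB coefMX coefMC /= => ->; ring.
have On0 : O n0%:R by exact: (vring_nat vO).
have OW k : O W`_k.
  have [m le] : exists m, (size W <= k + m)%N by exists (size W); exact: leq_addl.
  elim: m k le => [|m IHm] k le; last first.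
    rewrite coefW; apply: (vringD vO) => //; apply: (vringM vO) => //; apply: IHm.
    by rewrite addSnnS.
  by rewrite nth_default; [apply: vring0 | rewrite -(addn0 k)].
have MW k : (j < k)%N -> M W`_k.
  have [m le] : exists m, (size W <= k + m)%N by exists (size W); exact: leq_addl.
  elim: m k le => [|m IHm] k le jk; last first.
    rewrite coefW; apply: (vmaxD vO); first exact: MV.
    by apply: (vmaxMl vO) => //; apply: IHm; rewrite ?addSnnS // ltnW.
  by rewrite nth_default; [left | rewrite -(addn0 k)].
have [Wj0 OWj] : W`_j != 0 /\ O (W`_j)^-1.
  by rewrite coefW; apply: (vunitD vO) => //; apply: (vmaxMl vO) => //; apply: MW.
have /andP[n0l ul'] : (n0 \notin l) && uniq l by [].
have [] := IHj W l OW MW Wj0 OWj ul'.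
- by case: sl.
- by move=> n nl; apply: lD; rewrite in_cons nl orbT.
move=> n nl; apply.
have [a0 Ma0 e0] := HV n0 (mem_head _ _).
have nl' : n \in n0 :: l by rewrite in_cons nl orbT.
have [a Ma e] := HV n nl'.
have nn0 : n != n0 by apply: contraNneq n0l => <-.
have d0 : n%:R - n0%:R != 0 :> K by rewrite subr_eq0 eqr_nat.
exists ((a - a0) * (p%:R ^+ D / (n%:R - n0%:R))).
  apply: (vmaxMr vO); first exact: vmaxD vO _ _ Ma (vmaxN vO Ma0).
  by apply: vring_diff => //; apply: lD; rewrite // mem_head.
apply: (mulIf d0).
have := congr1 (fun q : {poly K} => q.[n%:R]) eW.
rewrite hornerM hornerXsubC hornerD hornerN hornerC => <-.
by rewrite e e0 mulnS exprD; field.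
Qed.

(** The Newton basis: [n ^_ k] as a polynomial in [n]. *)
Definition falling k : {poly K} := \prod_(i < k) ('X - i%:R%:P).

Lemma falling_monic k : falling k \is monic.
Proof. by rewrite rpred_prod // => i _; apply: monicXsubC. Qed.

Lemma size_falling k : size (falling k) = k.+1.
Proof. by rewrite size_prod_XsubC /index_enum -enumT size_enum_ord. Qed.

Lemma falling_coef k i : O (falling k)`_i.
Proof.
apply: vring_poly_coef_prod => // j l; rewrite coefB coefX coefC.
by apply: (vringB vO); [|case: ifP => _; last exact: vring0]; exact: (vring_nat vO).
Qed.

Lemma falling_lead k : (falling k)`_k = 1.
Proof. by have /monicP := falling_monic k; rewrite lead_coefE size_falling. Qed.

Lemma horner_falling k (n : nat) : (falling k).[n%:R] = (n ^_ k)%:R.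
Proof.
rewrite horner_prod; elim: k => [|k IHk]; first by rewrite big_ord0.
rewrite big_ord_recr /= IHk ffactnSr natrM !hornerE.
case: (leqP k n) => [le|lt]; first by rewrite natrB.
by rewrite ffact_small // !mul0r.
Qed.

(** Expand [w] in the Newton basis with coefficients [c k = q k p^(dk) / k!],
    where [q k] is the [k]-th difference at 0 divided by [p^(dk)].  The
    sequence [q] is annihilated by the polynomial whose roots are
    [(a - 1) / p^d], which are integral; so its largest term occurs among the
    first [size s] ones, and the factor [p^(dk) / k!] makes the later [c k]
    strictly smaller than the largest coefficient [c k0].  Hence
    [w / c k0] is dominated by its term of degree [k0 < size s], and
    [dominated_values] bounds [c k0]. *)
Lemma strassmann (d D : nat) (s : seq K) (w : nat -> K) (l : seq nat) :
  (size s <= d)%N -> (forall a, a \in s -> O ((a - 1) / p%:R ^+ d)) ->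
  annih w (root_poly s) ->
  uniq l -> size l = size s -> (forall n, n \in l -> (n < p ^ D)%N) ->
  (forall n, n \in l -> O (w n)) ->
  forall k, O (p%:R ^+ (D * d) * w k).
Proof.
move=> sd s1 ws ul sl lD Ow.
have pn0 n : p%:R ^+ n != 0 :> K by rewrite expf_neq0.
case Es: (size s) => [|e].
  move/eqP: Es; rewrite size_eq0 => /eqP s0 k.
  rewrite s0 /root_poly big_nil in ws.
  by rewrite (annih1 _ ws) mulr0; apply: vring0.
pose Y : {poly K} := p%:R ^- d *: ('X - 1).
pose q k := appl w (1 * Y ^+ k).
have qs : annih q (root_poly [seq Y.[a] | a <- s]) by apply: annih_map.
have Ys a : a \in [seq Y.[a] | a <- s] -> O a.
  by move=> /mapP[b bs ->]; rewrite !hornerE mulrC; apply: s1.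
have wE n : w n = \sum_(k < n.+1) 'C(n, k)%:R * p%:R ^+ (d * k) * q k.
  rewrite -(applXn w n).
  have -> : 'X = 1 + p%:R ^+ d *: Y :> {poly K}.
    by rewrite /Y scalerA mulfV // scale1r addrC subrK.
  rewrite exprDn linear_sum; apply: eq_bigr => k _.
  rewrite expr1n mul1r exprZn raddfMn /= linearZ /= /q mul1r -exprM.
  by rewrite -mulrnAl mulr_natl.
pose c k := p%:R ^+ (d * k) * q k / k`!%:R.
have fact0 k : k`!%:R != 0 :> K by rewrite pnatr_eq0 -lt0n fact_gt0.
have wc n : w n = \sum_(k < n.+1) c k * (n ^_ k)%:R.
  rewrite wE; apply: eq_bigr => k _; rewrite -bin_ffact natrM /c.
  by field; exact: fact0.
have [k0 k0e [big small]] := last_largest vO c e.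
have [j0 j0e [qbig _]] := last_largest vO q e.
have szY : size [seq Y.[a] | a <- s] = e.+1 by rewrite size_map.
have qj0 k : exists2 b, O b & q k = q j0 * b.
  have [q0|q0] := eqVneq (q j0) 0.
    exists 0; first exact: vring0.
    apply/eqP; rewrite mulr0; apply/negP => /negP qk0; apply: OpN.
    rewrite -[_^-1](mulfK qk0) mulrAC.
    apply: (bounded_recurrence vO Ys (annihZ (p%:R^-1 / q k) qs)) => i.
    rewrite szY ltnS => /qbig[b Ob ->]; rewrite q0 mul0r mulr0; exact: vring0.
  exists ((q j0)^-1 * q k); last by rewrite mulVKf.
  apply: (bounded_recurrence vO Ys (annihZ (q j0)^-1 qs)) => i.
  by rewrite szY ltnS => /qbig[b Ob ->]; rewrite mulKf.
(* [p^(d (k - j0)) / k!] lies in the maximal ideal: [k <= d * (k - j0)] because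
   [j0 <= e < k] and [e < d], while [logn p k! < k]. *)
have tail k : (e < k)%N -> exists2 a, M a & c k = c k0 * a.
  move=> ek; have [b Ob qk] := qj0 k; have [a Oa cj] := big j0 j0e.
  exists (a * (b * (j0`!%:R * (p%:R ^+ (d * (k - j0)) / k`!%:R)))).
    apply: (vmaxMl vO) => //; apply: (vmaxMl vO) => //.
    apply: (vmaxMl vO); first exact: (vring_nat vO).
    have k1 : (0 < k)%N by apply: leq_ltn_trans ek.
    have lt := logn_fact_lt p_pr k1.
    have [m ->] : exists m, (d * (k - j0) = logn p k`! + m.+1)%N.
      have de : (e < d)%N by rewrite -Es.
      exists (d * (k - j0) - (logn p k`!).+1)%N.
      suff : (k <= d * (k - j0))%N by lia.
      by nia.
    rewrite exprD mulrAC; apply: (vmaxMl vO); first by apply: vring_logn => //; apply: fact_gt0.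
    rewrite exprSr; apply: (vmaxMl vO); last exact: vmax_p.
    by apply: (vringX vO); apply: (vring_nat vO).
  rewrite mulrA -cj /c qk.
  have -> : (d * k = d * j0 + d * (k - j0))%N.
    by rewrite -mulnDr subnKC // ltnW // (leq_ltn_trans j0e).
  by rewrite exprD; field; rewrite !fact0.
have {}big k : exists2 a, O a & c k = c k0 * a.
  case: (leqP k e) => [/big //|/tail[a Ma ->]]; exists a => //; exact: vmaxW.
have {tail}small k : (k0 < k)%N -> exists2 a, M a & c k = c k0 * a.
  by move=> lt; case: (leqP k e) => [le|/tail //]; apply: small; rewrite lt.
suff Oc : O (p%:R ^+ (D * d) * c k0).
  move=> n; rewrite wc mulr_sumr; apply: (vring_sum vO) => i _.
  have [a Oa ->] := big i; rewrite mulrA [_ * (c k0 * a)]mulrA.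
  apply: (vringM vO); last exact: (vring_nat vO).
  by apply: (vringM vO).
have [c0|c0] := eqVneq (c k0) 0; first by rewrite c0 mulr0; apply: vring0.
apply: contrapT => nO.
have Minv : M (p%:R ^+ (D * d) * c k0)^-1 by right; rewrite invrK.
pose a k := (c k0)^-1 * c k.
have Oa k : O (a k) by have [b Ob e'] := big k; rewrite /a e' mulKf.
have Ma k : (k0 < k)%N -> M (a k).
  by move=> /small[b Mb e']; rewrite /a e' mulKf.
have a1 : a k0 = 1 by rewrite /a mulVf.
(* Only the values at [n < p ^ D] matter, where the Newton series is finite. *)
pose N := (p ^ D + k0.+1)%N.
pose V := \sum_(k < N) a k *: falling k.
have Vcoef i : V`_i = \sum_(k < N) a k * (falling k)`_i.
  by rewrite coef_sum; apply: eq_bigr => k _; rewrite coefZ.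
have VE n : (n < N)%N -> w n = c k0 * V.[n%:R].
  move=> lt; rewrite wc horner_sum mulr_sumr.
  rewrite (big_ord_widen N (fun k => c k * (n ^_ k)%:R)) // big_mkcond /=.
  apply: eq_bigr => k _; rewrite hornerZ horner_falling mulrA mulVKf //.
  by case: ltnP => // le; rewrite ffact_small ?mulr0.
have OV i : O V`_i.
  rewrite Vcoef; apply: (vring_sum vO) => k _.
  by apply: (vringM vO); [apply: Oa | apply: falling_coef].
have high i (k : 'I_N) : (k0 < k)%N || (k < i)%N -> M (a k * (falling k)`_i).
  case/orP=> lt; last by rewrite nth_default ?size_falling // mulr0; left.
  by apply: (vmaxMr vO); [apply: Ma | apply: falling_coef].
have MV i : (k0 < i)%N -> M V`_i.
  move=> lt; rewrite Vcoef; apply: (vmax_sum vO) => k _; apply: high.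
  by case: (ltnP k i) => [//|le]; rewrite ?orbT // (leq_trans lt).
have k0N : (k0 < N)%N by rewrite /N addnS ltnS leq_addl.
have [V0 OVinv] : V`_k0 != 0 /\ O (V`_k0)^-1.
  rewrite Vcoef (bigD1 (Ordinal k0N)) //= a1 falling_lead mulr1.
  apply: (vunitD vO); rewrite ?oner_neq0 ?invr1 //; first exact: (vring1 vO).
  apply: (vmax_sum vO) => k kk0; apply: high.
  by rewrite orbC -neq_ltn; apply: contraNneq kk0 => e'; apply/eqP/val_inj.
have sub n : n \in take k0.+1 l -> n \in l by apply: mem_take.
have [||n nl] := dominated_values (D := D) OV MV V0 OVinv (take_uniq k0.+1 ul).
- by rewrite size_takel // sl Es.
- by move=> n /sub/lD.
apply; have /sub nl' := nl; have nD := lD n nl'.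
exists (p%:R ^+ (D * (d - k0)) * w n * (p%:R ^+ (D * d) * c k0)^-1).
  apply: (vmaxMl vO) => //; apply: (vringM vO); last exact: Ow.
  by apply: (vringX vO); apply: (vring_nat vO).
rewrite VE; last by rewrite /N (leq_trans nD) ?leq_addr.
have -> : (D * d = D * k0 + D * (d - k0))%N.
  by rewrite -mulnDr subnKC // (leq_trans k0e) // (leq_trans _ sd) // Es.
by rewrite exprD; field; rewrite c0 !pn0.
Qed.

End Strassmann.

(** * Clustered zeros bound a sequence *)

(** The windows [[a D + b, 2^D)] are exponentially long in their starting point,
    and the parameter [b] pushes them to infinity. *)
Definition clustered (A : set nat) : Prop :=
  forall k a b : nat, exists D (l : seq nat),
    [/\ uniq l, size l = k & forall n, n \in l ->
      [/\ A n, (a * D + b <= n)%N & (n < 2 ^ D)%N]].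

Lemma appl_MXn (K : fieldType) (u : nat -> K) (P : {poly K}) k :
  appl u (P * 'X^k) = \sum_(i < size P) P`_i * u (i + k)%N.
Proof.
rewrite -[in LHS](coefK P) poly_def mulr_suml linear_sum; apply: eq_bigr => i _.
by rewrite -scalerAl -exprD linearZ /= applXn.
Qed.

Lemma root_poly_cat (K : fieldType) (s : seq K) (P : pred K) :
  root_poly s = root_poly [seq a <- s | P a] * root_poly [seq a <- s | ~~ P a].
Proof. by rewrite /root_poly !big_filter (bigID P). Qed.

Lemma coprimep_root_poly (K : fieldType) (s t : seq K) :
  (forall a, a \in s -> a \notin t) -> coprimep (root_poly s) (root_poly t).
Proof.
elim: s => [|a s IHs] st; first by rewrite /root_poly big_nil coprime1p.
rewrite /root_poly big_cons coprimepMl IHs ?andbT; last first.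
  by move=> b bs; apply: st; rewrite in_cons bs orbT.
by rewrite coprimep_sym coprimep_XsubC root_prod_XsubC st ?mem_head.
Qed.

Section Peel.
Variables (p : nat) (K : numFieldType) (O : set K).
Hypotheses (p_pr : prime p) (pO : padic_ring p O).
Local Notation M := (vmax O).
Let vO : valuation_ring O := pO.
Let p0 : p%:R != 0 :> K := pnat_neq0 K p_pr.
Let pX0 n : p%:R ^+ n != 0 :> K. Proof. by rewrite expf_neq0. Qed.
Let OpX n : O (p%:R ^+ n). Proof. by apply: (vringX vO); apply: (vring_nat vO). Qed.

Lemma vring_pow_le x i j : (i <= j)%N -> O (p%:R ^+ i * x) -> O (p%:R ^+ j * x).
Proof. by move=> /subnK <- Ox; rewrite exprD -mulrA; apply: (vringM vO). Qed.

(** The valuation has rank one: some power of [x] is divisible by [p]. *)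
Lemma padic_decay x : M x ->
  exists r, forall n t, (r * t <= n)%N -> O (x ^+ n / p%:R ^+ t).
Proof.
move=> Mx; have [r Or] := padic_nilp pO Mx; exists r => n t le.
rewrite -(subnK le) exprD exprM -mulrA -expr_div_n.
by apply: (vringM vO); apply: (vringX vO) => //; apply: vmaxW.
Qed.

Lemma padic_bounded_poly (P : {poly K}) : exists h, forall i, O (p%:R ^+ h * P`_i).
Proof.
suff [h Oh] : exists h, forall i, (i < size P)%N -> O (p%:R ^+ h * P`_i).
  exists h => i; case: (ltnP i (size P)) => [/Oh //|le].
  by rewrite nth_default // mulr0; apply: vring0.
elim: (size P) => [|n [h IH]]; first by exists 0%N.
have [c Oc] := padic_bounded pO P`_n; exists (h + c)%N => i.
rewrite ltnS leq_eqVlt => /orP[/eqP->|/IH].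
  by apply: vring_pow_le Oc; apply: leq_addl.
by apply: vring_pow_le; apply: leq_addr.
Qed.

Lemma exists_largest (a : K) (s : seq K) : (forall b, b \in a :: s -> b != 0) ->
  exists2 m, m \in a :: s & forall b, b \in a :: s -> O (b / m).
Proof.
elim: s a => [|c s IHs] a s0.
  exists a => [|b]; rewrite mem_seq1 // => /eqP ->.
  by rewrite divff ?s0 ?mem_head //; apply: vring1.
have [|m ms mM] := IHs c; first by move=> b bs; apply: s0; rewrite in_cons bs orbT.
have m0 : m != 0 by apply: s0; rewrite in_cons ms orbT.
have a0 : a != 0 by apply: s0; rewrite mem_head.
case: (vring_total vO (a / m)) => [Oam|Oma].
  exists m => [|b]; first by rewrite in_cons ms orbT.
  by rewrite in_cons => /orP[/eqP->|/mM].
exists a => [|b]; rewrite ?mem_head // in_cons => /orP[/eqP->|/mM Ob].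
  by rewrite divff //; apply: vring1.
have -> : b / a = b / m * (a / m)^-1 by field; rewrite a0 m0.
exact: (vringM vO).
Qed.

(** The bound [C'] does not depend on [B]: a sequence that is bounded initially
    and on [A] is bounded everywhere, and [B'] only says how far the values on
    [A] have to be controlled to reach [B].  Induction on the roots: let [b]
    be a largest root and split [u = u1 + u2] along the roots as large as [b]
    and the others.  A cluster far beyond [B''], which is what the
    induction hypothesis requires for [u2], shows that [u1] is bounded up
    to [B'']; then [u2 = u - u1] is bounded on [A] up to [B'']. *)
Lemma peel d (A : set nat) : clustered A -> forall s C, (size s <= d)%N ->
  (forall a, a \in s -> a != 0 /\ O a^-1) ->
  (forall a b, a \in s -> b \in s -> O (a / b) -> O (b / a) ->
     O ((a / b - 1) / p%:R ^+ d)) ->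
  exists C', forall B, exists B', forall u : nat -> K, annih u (root_poly s) ->
    (forall k, (k < size s)%N -> O (p%:R ^+ C * u k)) ->
    (forall n, A n -> (n <= B')%N -> O (p%:R ^+ C * u n)) ->
    forall k, (k <= B)%N -> O (p%:R ^+ C' * u k).
Proof.
move=> clA s; have [m] := ubnP (size s); elim: m s => // m IHm s ltsm C sd s1 sclose.
case Es: s => [|a0 s'].
  exists 0%N => B; exists 0%N => u us _ _ k _.
  by rewrite annih1 ?mulr0; [apply: vring0 | move: us; rewrite /root_poly big_nil].
have [b bs bmax] : exists2 b, b \in s & forall a, a \in s -> O (a / b).
  by rewrite Es; apply: exists_largest => a; rewrite -Es => /s1[].
rewrite -Es; have [b0 Oib] := s1 b bs.
have [Ob|nOb] := pselect (O b).
  exists C => B; exists 0%N => u us u0 _ k _.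
  apply: (bounded_recurrence vO _ (annihZ (p%:R ^+ C) us)) => // a /bmax Oa.
  by rewrite -(divfK b0 a); apply: (vringM vO).
have Mib : M b^-1 by right; rewrite invrK.
pose tb a := `[< O (b / a) >].
pose top := [seq a <- s | tb a]; pose rest := [seq a <- s | ~~ tb a].
have top_s a : a \in top -> a \in s by rewrite mem_filter => /andP[].
have rest_s a : a \in rest -> a \in s by rewrite mem_filter => /andP[].
have rest_d : (size rest <= d)%N by rewrite size_filter (leq_trans (count_size _ _)).
have top_d : (size top <= d)%N by rewrite size_filter (leq_trans (count_size _ _)).
have rest_m : (size rest < m)%N.
  have : (0 < count tb s)%N.
    rewrite -has_count; apply/hasP; exists b => //.
    by apply/asboolP; rewrite divff //; apply: vring1.
  move=> c0; rewrite -ltnS (leq_trans _ ltsm) // ltnS /rest size_filter.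
  by rewrite -(count_predC tb s) -add1n leq_add2r.
have G12 : root_poly s = root_poly top * root_poly rest by apply: root_poly_cat.
have [[U1 U2] /= bez] : exists U : {poly K} * {poly K},
    U.1 * root_poly top + U.2 * root_poly rest = 1.
  apply/Bezout_eq1_coprimepP/coprimep_root_poly => a.
  by rewrite !mem_filter => /andP[-> _].
pose H1 := U2 * root_poly rest; pose H2 := U1 * root_poly top.
have [l Ol] := padic_bounded pO b.
have Olk k : O (p%:R ^+ (l * k) * b ^+ k).
  by rewrite exprM -exprMn; apply: (vringX vO).
have [h Oh] := padic_bounded_poly H2.
(* [C1] bounds the initial values of [u2], which involve [u] up to
   [size H2 + d]; [h] bounds the coefficients of [H2]. *)
pose C1 := (h + (C + l * (size H2 + d)))%N.
pose u1 (u : nat -> K) n := appl u (H1 * 'X^n).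
pose u2 (u : nat -> K) n := appl u (H2 * 'X^n).
have u12 u n : u n = u1 u n + u2 u n.
  by rewrite /u1 /u2 -linearD /= -mulrDl /H1 /H2 addrC bez mul1r applXn.
have ann1 u : annih u (root_poly s) -> annih (u1 u) (root_poly top).
  by move=> us; apply: annihM us _; rewrite G12 /H1 -mulrA [X in _ %| _ * X]mulrC dvdp_mull.
have ann2 u : annih u (root_poly s) -> annih (u2 u) (root_poly rest).
  by move=> us; apply: annihM us _; rewrite G12 /H2 -mulrA dvdp_mull.
have init2 u : annih u (root_poly s) ->
    (forall k, (k < size s)%N -> O (p%:R ^+ C * u k)) ->
    forall k, (k < size rest)%N -> O (p%:R ^+ C1 * u2 u k).
  move=> us u0.
  have gr : forall k, O (p%:R ^+ C * u k / b ^+ k).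
    apply: (growth_bound vO b0 bmax us) => k lt; apply: (vringM vO); first exact: u0.
    by rewrite -exprVn; apply: (vringX vO).
  move=> k lt; rewrite /u2 appl_MXn mulr_sumr; apply: (vring_sum vO) => i _.
  have lik : (i + k <= size H2 + d)%N.
    by apply: leq_add; [apply: ltnW | apply: leq_trans (ltnW lt) _].
  rewrite /C1 exprD mulrACA; apply: (vringM vO); first exact: Oh.
  apply: (@vring_pow_le _ (C + l * (i + k))).
    by rewrite leq_add2l leq_mul2l lik orbT.
  have -> : p%:R ^+ (C + l * (i + k)) * u (i + k)%N =
     p%:R ^+ C * u (i + k)%N / b ^+ (i + k) * (p%:R ^+ (l * (i + k)) * b ^+ (i + k)).
    by rewrite exprD; field; rewrite expf_neq0.
  exact: (vringM vO).
have [r decay] : exists r, forall u, annih u (root_poly s) ->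
    (forall k, (k < size s)%N -> O (p%:R ^+ C * u k)) -> forall n t,
    (r * t <= n)%N -> O (b^-1 ^+ n / p%:R ^+ t) /\
      O (p%:R ^+ C1 * u2 u n * b^-1 ^+ n / p%:R ^+ t).
  have [r1 dec1] := padic_decay Mib.
  case Er: rest => [|c0 rest'].
    exists r1 => u us u0 n t le; split; first exact: dec1.
    rewrite (annih1 _ (u := u2 u)) ?(mulr0, mul0r); first exact: vring0.
    by have := ann2 u us; rewrite Er /root_poly big_nil.
  have [c cs cmax] : exists2 c, c \in rest & forall a, a \in rest -> O (a / c).
    by rewrite Er; apply: exists_largest => a; rewrite -Er => /rest_s/s1[].
  have [c_0 Oic] := s1 c (rest_s c cs).
  have Mcb : M (c / b).
    right; rewrite invf_div => Obc.
    by move: cs; rewrite mem_filter /tb => /andP[/asboolP].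
  have [r2 dec2] := padic_decay Mcb.
  exists (r1 + r2)%N => u us u0 n t le; split.
    by apply: dec1; apply: leq_trans le; rewrite leq_mul2r leq_addr orbT.
  have gr : forall k, O (p%:R ^+ C1 * u2 u k / c ^+ k).
    apply: (growth_bound vO c_0 cmax (ann2 u us)) => k lt.
    apply: (vringM vO); first exact: init2.
    by rewrite -exprVn; apply: (vringX vO).
  have -> : p%:R ^+ C1 * u2 u n * b^-1 ^+ n / p%:R ^+ t =
      p%:R ^+ C1 * u2 u n / c ^+ n * ((c / b) ^+ n / p%:R ^+ t).
    by rewrite expr_div_n exprVn; field; rewrite pX0 !expf_neq0.
  apply: (vringM vO) => //; apply: dec2.
  by apply: leq_trans le; rewrite leq_mul2r leq_addl orbT.
pose C3 := (C + C1)%N.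
have [||C' IH] := IHm rest rest_m C3 rest_d.
- by move=> a /rest_s/s1.
- by move=> x y /rest_s xs /rest_s ys; apply: sclose.
exists (C' + C3)%N => B; have [B'' HB''] := IH B.
pose B2 := maxn B B''.
have [D [L [uL sL LA]]] := clA (size top) (r * d)%N (r * (l * B2))%N.
have LD n : n \in L -> (n < 2 ^ D)%N by case/LA.
exists (2 ^ D + B2)%N => u us u0 uA.
(* [u1 n / b^n] gains [t] powers of [p] at the points of the cluster: [d * D]
   pay for the loss in [strassmann], [l * B2] for the growth of [b^k] up to
   [k = B2]. *)
pose t := (d * D + l * B2)%N.
have small1 k : (k <= B2)%N -> O (p%:R ^+ C3 * u1 u k).
  move=> kB; pose w n := p%:R ^+ C3 / p%:R ^+ t * appl (u1 u) (1 * (b^-1 *: 'X) ^+ n).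
  have wE n : w n = p%:R ^+ C3 * u1 u n * b^-1 ^+ n / p%:R ^+ t.
    by rewrite /w mul1r exprZn linearZ /= applXn; ring.
  have Ow : forall k, O (p%:R ^+ (D * d) * w k).
    apply: (@strassmann _ _ _ p_pr pO d D [seq (b^-1 *: 'X : {poly K}).[a] | a <- top] w L) => //.
    - by rewrite size_map.
    - move=> _ /mapP[a ta ->]; rewrite hornerZ hornerX [b^-1 * a]mulrC.
      apply: sclose => //; first exact: top_s; first exact/bmax/top_s.
      by move: ta; rewrite mem_filter => /andP[/asboolP].
    - by apply: annihZ; apply: annih_map; apply: ann1.
    - by rewrite size_map.
    - move=> n /LD lt; apply: leq_trans lt _.
      by case: (D) => // D'; rewrite leq_exp2r ?prime_gt1.
    move=> n nL; have [An le lt] := LA n nL; rewrite wE.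
    have [] := decay u us u0 n t; first by rewrite /t mulnDr [(r * (d * D))%N]mulnA.
    move=> d1 d2.
    have -> : u1 u n = u n - u2 u n by rewrite [u n]u12 addrK.
    rewrite mulrBr !mulrBl; apply: (vringB vO).
      rewrite -mulrA; apply: (vringM vO) => //.
      apply: (@vring_pow_le _ C); first exact: leq_addr.
      by apply: uA => //; apply: leq_trans (ltnW lt) (leq_addr _ _).
    rewrite /C3 exprD -!mulrA; apply: (vringM vO) => //; by rewrite !mulrA.
  have -> : p%:R ^+ C3 * u1 u k =
      p%:R ^+ (D * d) * w k * (p%:R ^+ (l * B2) * b ^+ k).
    rewrite wE /t [(d * D)%N]mulnC exprD exprVn; field.
    by rewrite !pX0 expf_neq0.
  apply: (vringM vO) => //; apply: vring_pow_le (Olk k).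
  by rewrite leq_mul2l kB orbT.
have bound2 k : (k <= B)%N -> O (p%:R ^+ C' * u2 u k).
  apply: HB'' => [|n lt|n An nB]; first exact: ann2.
    by apply: (@vring_pow_le _ C1); [apply: leq_addl | apply: init2].
  have -> : u2 u n = u n - u1 u n by rewrite [u n]u12 addrC addKr.
  have nB2 : (n <= B2)%N by rewrite leq_max nB orbT.
  rewrite mulrBr; apply: (vringB vO); last exact: small1.
  apply: (@vring_pow_le _ C); first exact: leq_addr.
  by apply: uA => //; apply: leq_trans nB2 (leq_addl _ _).
move=> k kB; rewrite [u k]u12 mulrDr; apply: (vringD vO).
  by apply: (@vring_pow_le _ C3); [apply: leq_addl | apply: small1; rewrite leq_max kB].
by apply: (@vring_pow_le _ C'); [apply: leq_addr | apply: bound2].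
Qed.

End Peel.

(** * Sparse sets and iterated logarithms *)
Section Counting.
Variable A : set nat.

Lemma initial_count_iota n :
  initial_count A n = count (fun i => i \in A) (iota 0 n.+1).
Proof.
by rewrite /initial_count cardE size_filter -enumT -val_enum_ord count_map.
Qed.

Lemma initial_count_mono m n : (m <= n)%N -> (initial_count A m <= initial_count A n)%N.
Proof.
rewrite !initial_count_iota -ltnS => le.
by rewrite -(subnKC le) iotaD count_cat leq_addr.
Qed.

Lemma initial_count_le n : (initial_count A n <= n.+1)%N.
Proof. by rewrite initial_count_iota (leq_trans (count_size _ _)) // size_iota. Qed.

(** Use the window whose upper end [2 ^ D] is just above [n]: its lower end is,
    up to constants, a multiple of [log n]. *)
Lemma not_clustered_count : ~ clustered A -> exists k a b : nat,
  (0 < a)%N /\ forall n, (initial_count A n <=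
    initial_count A (a * (trunc_log 2 n).+1 + b) + k)%N.
Proof.
move=> nC; have [k [a [b H]]] : exists k a b : nat, ~ exists D (l : seq nat),
    [/\ uniq l, size l = k & forall n, n \in l ->
      [/\ A n, (a * D + b <= n)%N & (n < 2 ^ D)%N]].
  by apply: contrapT => nE; apply: nC => k a b; apply: contrapT => nD; apply: nE; exists k, a, b.
exists k, a.+1, b; split=> // n; set D := (trunc_log 2 n).+1.
have nD : (n < 2 ^ D)%N by apply: trunc_log_ltn.
set t := (a.+1 * D + b)%N.
case: (leqP n t) => [le|tn].
  by apply: leq_trans (leq_addr _ _); apply: initial_count_mono.
rewrite !initial_count_iota.
have -> : iota 0 n.+1 = iota 0 t.+1 ++ iota t.+1 (n - t).
  by rewrite -iotaD; congr iota; lia.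
rewrite count_cat leq_add2l leqNgt; apply/negP => lt; apply: H.
exists D, (take k [seq i <- iota t.+1 (n - t) | i \in A]).
rewrite take_uniq ?filter_uniq ?iota_uniq //; split=> //.
  by rewrite size_takel // size_filter ltnW.
move=> i /mem_take; rewrite mem_filter mem_iota => /andP[/set_mem Ai /andP[ti iN]].
by split=> //; move: ti iN nD; rewrite /t; lia.
Qed.

End Counting.

Section IteratedLog.
Variable R : realType.
Local Notation L := (@iterated_log R).

Lemma iterated_log_large m (B : R) : exists Y : R, forall y, Y <= y -> B <= L m y.
Proof.
elim: m B => [|m IH] B; first by exists B.
have [Y HY] := IH (expR B); exists Y => y /HY le.
rewrite /iterated_log iterS -[B]expRK ler_ln ?posrE ?expR_gt0 //.
by apply: lt_le_trans le; exact: expR_gt0.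
Qed.

(** A multiplicative constant inside an iterated logarithm can be moved
    outside, since each logarithm turns it into an additive one. *)
Lemma iterated_log_scale m (C : R) : 0 < C -> exists C' Y : R, 0 < C' /\
  forall x y, Y <= x -> Y <= y -> x <= C * y -> L m x <= C' * L m y.
Proof.
move=> C0; elim: m => [|m [C' [Y [C'0 IH]]]]; first by exists C, 0.
have [Y1 H1] := iterated_log_large m 1.
have [Y2 H2] := iterated_log_large m.+1 (ln C').
exists 2, (Num.max Y (Num.max Y1 Y2)); split=> // x y.
rewrite !ge_max => /andP[xY /andP[xY1 xY2]] /andP[yY /andP[yY1 yY2]] xy.
have Lx : 0 < L m x by apply: lt_le_trans (H1 x xY1).
have Ly : 0 < L m y by apply: lt_le_trans (H1 y yY1).
have le : L m.+1 x <= ln C' + L m.+1 y.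
  rewrite /iterated_log !iterS -lnM ?posrE // ler_ln ?posrE ?mulr_gt0 //.
  exact: IH.
by have := H2 y yY2; lra.
Qed.

(** From [ln y = 2 ln (sqrt y) < 2 sqrt y]. *)
Lemma ln_small (e : R) : 0 < e -> exists Y : R, forall y, Y <= y -> ln y <= e * y.
Proof.
move=> e0; exists ((2 / e) ^+ 2) => y yY.
have c0 : 0 < 2 / e by rewrite divr_gt0.
have y0 : 0 < y by apply: lt_le_trans yY; rewrite exprn_gt0.
have s0 : 0 < Num.sqrt y by rewrite sqrtr_gt0.
have sE : Num.sqrt y ^+ 2 = y by rewrite sqr_sqrtr // ltW.
have le : 2 / e <= Num.sqrt y.
  by rewrite -(ler_pXn2r (n := 2)) ?sE // nnegrE ltW.
have ls := ln_sublinear s0.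
have le2 : 2 <= e * Num.sqrt y by rewrite mulrC -ler_pdivrMr.
rewrite -{1}sE lnXn // -{2}sE mulr2n expr2 mulrA.
have : 2 * Num.sqrt y <= e * Num.sqrt y * Num.sqrt y by rewrite ler_pM2r.
by lra.
Qed.

Variable A : set nat.

Lemma sparse_count_iterated_log k a b m : (0 < a)%N ->
  (forall n, (initial_count A n <=
     initial_count A (a * (trunc_log 2 n).+1 + b) + k)%N) ->
  exists C : R, exists N : nat, 0 < C /\ forall n : nat, (N <= n)%N ->
    (initial_count A n)%:R <= C * L m n%:R.
Proof.
move=> a0 Hc; elim: m => [|m [C [N [C0 IH]]]].
  exists 2, 1%N; split=> // n n1; rewrite /iterated_log /=.
  have := initial_count_le A n; rewrite -(ler_nat R) -natr1.
  have : (1 : R) <= n%:R by rewrite ler1n.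
  by lra.
have ln2 : 0 < ln (2 : R) by rewrite ln_gt0 // ltr1n.
pose C1 : R := a%:R * ((ln 2)^-1 + 1) + b%:R.
have C10 : 0 < C1.
  apply: ltr_wpDr => //; apply: mulr_gt0; first by rewrite ltr0n.
  by apply: addr_gt0; rewrite ?invr_gt0.
have [C2 [Y [C20 HY]]] := iterated_log_scale m C10.
have [Y1 H1] := iterated_log_large m.+1 1.
have [Y2 H2] := iterated_log_large 1 (Num.max 1 Y).
have big (Z : R) : exists n0 : nat, forall n : nat, (n0 <= n)%N -> Z <= n%:R.
  exists (Num.bound `|Z|) => n le.
  have := ltW (archi_boundP (normr_ge0 Z)); have := ler_norm Z.
  by rewrite -(ler_nat R) in le; lra.
have [nY HnY] := big Y; have [nY1 HnY1] := big Y1; have [nY2 HnY2] := big Y2.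
exists (C * C2 + k%:R), (maxn (2 ^ (N + nY)) (maxn 1 (maxn nY1 nY2))).
split; first by apply: ltr_wpDr => //; apply: mulr_gt0.
move=> n; rewrite !geq_max => /andP[n2 /andP[n1 /andP[ny1 ny2]]].
have D2 : (2 ^ trunc_log 2 n <= n)%N by apply: trunc_logP.
have DN : (N + nY <= trunc_log 2 n)%N by apply: trunc_log_max.
set t := (a * (trunc_log 2 n).+1 + b)%N.
have tN : (N + nY <= t)%N by rewrite /t; nia.
have lnn : Num.max 1 Y <= ln n%:R by have := H2 _ (HnY2 n ny2).
have n0 : 0 < n%:R :> R by rewrite ltr0n.
have Dln : (trunc_log 2 n)%:R * ln 2 <= ln n%:R :> R.
  rewrite mulr_natl -lnXn // ler_ln ?posrE ?exprn_gt0 //.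
  by rewrite -natrX ler_nat.
have tln : t%:R <= C1 * ln n%:R.
  rewrite /t natrD natrM -natr1 /C1 mulrDl.
  move: lnn; rewrite ge_max => /andP[ln1 _].
  apply: lerD; last by rewrite -{1}[b%:R]mulr1 ler_wpM2l.
  rewrite -mulrA ler_wpM2l //.
  by rewrite mulrDl mul1r lerD // mulrC ler_pdivlMr.
have tm : L m t%:R <= C2 * L m (ln n%:R).
  apply: HY => //; first by apply: HnY; lia.
  by move: lnn; rewrite ge_max => /andP[].
have c1 : (initial_count A n)%:R <= (initial_count A t)%:R + k%:R :> R.
  by rewrite -natrD ler_nat; apply: Hc.
have c2 : (initial_count A t)%:R <= C * L m t%:R by apply: IH; lia.
have l1 : 1 <= L m.+1 n%:R by apply: H1; apply: HnY1.
have lS : L m.+1 n%:R = L m (ln n%:R) by rewrite /iterated_log iterSr.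
have c3 : C * L m t%:R <= C * (C2 * L m (ln n%:R)) by rewrite ler_wpM2l // ltW.
have k1 : k%:R <= k%:R * L m.+1 n%:R :> R by rewrite -{1}[k%:R]mulr1 ler_wpM2l.
by rewrite mulrDl -mulrA lS; rewrite lS in k1; lra.
Qed.

Lemma not_clustered_very_sparse : ~ clustered A -> very_sparse R A.
Proof.
move=> /not_clustered_count[k [a [b [a0 Hc]]]] m _.
have [C [N [C0 HN]]] := sparse_count_iterated_log m.+1 a0 Hc.
apply/eqoP => e e0.
have [Y HY] := ln_small (divr_gt0 e0 C0).
have [Y1 H1] := iterated_log_large m Y.
near=> n.
rewrite normr_nat.
have /HN le : (N <= n)%N by near: n; exact: nbhs_infty_ge.
apply: le_trans le _.
have nY1 : Y1 <= n%:R :> R.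
  near: n; exists (Num.bound `|Y1|) => // n /= le.
  have := ltW (archi_boundP (normr_ge0 Y1)); have := ler_norm Y1.
  by rewrite -(ler_nat R) in le; lra.
have le := HY _ (H1 _ nY1).
have -> : L m.+1 n%:R = ln (L m n%:R) by rewrite /iterated_log iterS.
apply: (@le_trans _ _ (e * L m n%:R)); last first.
  by apply: ler_wpM2l; [exact: ltW | exact: ler_norm].
by rewrite -(ler_pM2l C0) in le; apply: le_trans le _; rewrite mulrA mulrCA mulfV ?gt_eqF // mulr1.
Unshelve. all: by end_near. Qed.

End IteratedLog.

(** * Recurrences over the rationals modulo 1 *)
Lemma pi_ideal_quotB (V : zmodType) (I : zmodClosed V) :
  zmod_morphism (\pi_(Quotient.quot I)).
Proof. exact: pi_is_zmod_morphism. Qed.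

Local Notation int_in_rat := (GRing.ZmodClosed.clone rat (@Num.int_num_subdef rat) _).

Definition rat_class : rat -> rat_mod_int := \pi_(Quotient.quot int_in_rat).

Lemma rat_class_is_zmod_morphism : zmod_morphism rat_class.
Proof. exact: (pi_ideal_quotB int_in_rat). Qed.

HB.instance Definition _ :=
  GRing.isZmodMorphism.Build rat rat_mod_int rat_class rat_class_is_zmod_morphism.

Lemma rat_class_surj (x : rat_mod_int) : exists y, rat_class y = x.
Proof.
exists (repr (x : Quotient.quot int_in_rat)).
exact: (reprK (x : Quotient.quot int_in_rat)).
Qed.

Lemma rat_class_eq0 y : rat_class y = 0 <-> y \is a Num.int.
Proof.
rewrite -(raddf0 rat_class); have := @Quotient.idealrBE rat _ y 0.
by rewrite subr0 => e; split => [/eqP|H]; [rewrite -e | apply/eqP; rewrite -e].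
Qed.

Lemma denq_dvd (y : rat) (B : nat) : rat_class y *+ B = 0 <-> (`|denq y| %| B)%N.
Proof.
rewrite -raddfMn rat_class_eq0 -[y *+ B]mulr_natr; split=> [/intrP[z e]|/dvdnP[k ->]].
  have ez : numq y * B%:Z = z * denq y.
    apply/eqP; rewrite -(eqr_int rat) !rmorphM /= -e numqE -[B%:~R]/(B%:R : rat).
    by apply/eqP; ring.
  have : (denq y %| numq y * B%:Z)%Z by rewrite ez dvdz_mull.
  by rewrite Gauss_dvdzr ?dvdzE // coprimezE coprime_sym coprime_num_den.
rewrite natrM mulrCA -[(`|_|%N)%:R]/(`|denq y|%:Z%:~R : rat) absz_denq -numqE.
by rewrite rpredM ?natr_int ?intr_int.
Qed.

(** A sequence annihilated by [P] is a linear form on the quotient by [P]; take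
    the one with the prescribed values on the standard basis. *)
Lemma exists_recurrence (F : fieldType) (P : {poly F}) (c : nat -> F) : P != 0 ->
  exists2 u, annih u P & forall i, (i < (size P).-1)%N -> u i = c i.
Proof.
move=> P0; pose ell (G : {poly F}) := appl c (G %% P).
exists (fun n => ell 'X^n) => [G|i lt]; last first.
  by rewrite /ell modp_small ?applXn // size_polyXn -ltn_predRL.
suff -> H : appl (fun n => ell 'X^n) H = ell H by rewrite /ell modp_mull linear0.
have ellD G1 G2 : ell (G1 + G2) = ell G1 + ell G2 by rewrite /ell modpD linearD.
have ell0 : ell 0 = 0 by rewrite /ell mod0p linear0.
rewrite -[in RHS](coefK H) poly_def (big_morph ell ellD ell0).
by apply: eq_bigr => i _; rewrite /ell modpZl linearZ.
Qed.

Section Recurrence.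
Variables (m : nat) (a : 'I_m -> int).

Definition rec_poly (F : fieldType) : {poly F} :=
  1 + \sum_(i < m) (a i)%:~R *: 'X^(i.+1).

Lemma rec_poly_coef0 (F : fieldType) : (rec_poly F)`_0 = 1.
Proof.
rewrite coefD coef1 eqxx coef_sum big1 ?addr0 // => i _.
by rewrite coefZ coefXn mulr0.
Qed.

Lemma rec_poly_coefS (F : fieldType) (i : 'I_m) : (rec_poly F)`_i.+1 = (a i)%:~R.
Proof.
rewrite coefD coef1 coef_sum (bigD1 i) //= coefZ coefXn eqxx mulr1 big1 ?addr0 ?add0r //.
by move=> j ji; rewrite coefZ coefXn eqSS eq_sym val_eqE (negbTE ji) mulr0.
Qed.

Lemma rec_poly_neq0 (F : fieldType) : rec_poly F != 0.
Proof.
apply/eqP => e; have := rec_poly_coef0 F; rewrite e coef0 => /eqP.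
by rewrite eq_sym oner_eq0.
Qed.

(** A root in the maximal ideal would make the constant term 1 a non-unit. *)
Lemma rec_poly_root (F : fieldType) (O : set F) (b : F) : valuation_ring O ->
  root (rec_poly F) b -> b != 0 /\ O b^-1.
Proof.
move=> vO /rootP; rewrite /rec_poly hornerD hornerC horner_sum => e.
case: (vring_dichotomy O b) => // Mb; case: (vmax1 vO).
have -> : 1 = - \sum_(i < m) ((a i)%:~R *: 'X^(i.+1)).[b].
  by apply/eqP; rewrite -addr_eq0 e.
apply/(vmaxN vO)/(vmax_sum vO) => i _; rewrite hornerZ hornerXn exprSr mulrA.
apply: (vmaxMl vO) => //; apply: (vringM vO); first exact: vring_int.
by apply: (vringX vO); apply: (vmaxW vO).
Qed.

Lemma appl_rec_poly (F : fieldType) (u : nat -> F) n :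
  appl u ('X^n * rec_poly F) = u n + \sum_(i < m) (a i)%:~R * u (n + i.+1)%N.
Proof.
rewrite mulrDr mulr1 linearD /= applXn mulr_sumr linear_sum; congr (_ + _).
by apply: eq_bigr => i _; rewrite -scalerAr -exprD linearZ /= applXn.
Qed.

Lemma rec_poly_rat (F : numFieldType) : rec_poly F = map_poly ratr (rec_poly rat).
Proof.
rewrite /rec_poly rmorphD rmorph1 rmorph_sum; congr (_ + _); apply: eq_bigr => i _ /=.
by rewrite map_polyZ map_polyXn rmorph_int.
Qed.

Lemma size_rec_poly_rat (F : numFieldType) : size (rec_poly F) = size (rec_poly rat).
Proof. by rewrite rec_poly_rat size_map_poly. Qed.

(** The recurrence determines earlier terms from later ones, over the rationals
    and modulo 1 alike: lift a window of [x] beyond [N] and go down. *)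
Lemma rational_lift N (x : nat -> rat_mod_int) :
  satisfies_inverse_monic_recurrence a x ->
  exists2 u : nat -> rat, annih u (rec_poly rat) &
    forall i, (i < N + (size (rec_poly rat)).-1)%N -> rat_class (u i) = x i.
Proof.
elim: N x => [|N IHN] x hx.
  have /choice[c hc] i := rat_class_surj (x i).
  have [u Pu hu] := exists_recurrence c (rec_poly_neq0 rat).
  by exists u => // i lt; rewrite hu ?hc.
have [|u Pu hu] := IHN (fun n => x n.+1).
  move=> n; rewrite -[RHS](hx n.+1); congr (_ + _).
exists (fun n => if n is k.+1 then u k else - \sum_(i < m) (a i)%:~R * u i).
  apply: annihP => -[|n]; rewrite appl_rec_poly /=.
    by rewrite addNr.
  by rewrite -appl_rec_poly Pu.
case=> [_|i]; last by rewrite ltnS; apply: hu.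
rewrite raddfN raddf_sum; apply/eqP; rewrite eq_sym -addr_eq0 -[X in _ == X](hx 0%N) addrC.
rewrite eq_sym; apply/eqP; congr (_ + _); apply: eq_bigr => i _ /=.
rewrite mulrzl raddfMz /=; have [lt|le] := ltnP i (size (rec_poly rat)).-1.
  by rewrite hu // ltn_addl.
suff -> : a i = 0 by rewrite !mulr0z.
apply/eqP; rewrite -(intr_eq0 rat) -rec_poly_coefS nth_default //.
exact: leq_trans (leqSpred _) _.
Qed.

Lemma annih_ratr (F : numFieldType) (u : nat -> rat) :
  annih u (rec_poly rat) -> annih (fun n => ratr (u n) : F) (rec_poly F).
Proof.
move=> Pu; apply: annihP => n; rewrite appl_rec_poly -[RHS](rmorph0 (ratr : rat -> F)).
rewrite -[in RHS](Pu 'X^n) appl_rec_poly rmorphD rmorph_sum; congr (_ + _).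
by apply: eq_bigr => i _; rewrite rmorphM /= ratr_int.
Qed.

End Recurrence.

(** * Bounded torsion on residue classes *)
Section UnitPowers.
Variables (p : nat) (K : numFieldType) (O : set K).
Hypotheses (p_pr : prime p) (pO : padic_ring p O).
Let vO : valuation_ring O := pO.
Let OpN := padic_pN pO.
Let p0 : p%:R != 0 :> K := pnat_neq0 K p_pr.
Let pX0 n : p%:R ^+ n != 0 :> K. Proof. by rewrite expf_neq0. Qed.

Lemma vring_root x n : (0 < n)%N -> O (x ^+ n) -> O x.
Proof.
move=> n0 Oxn; case: (vring_total vO x) => // Ox.
have [x0|x0] := eqVneq x 0; first by rewrite x0; apply: vring0.
suff -> : x = x ^+ n * x^-1 ^+ n.-1 by apply: (vringM vO) => //; apply: (vringX vO).
by rewrite -(prednK n0) exprS /= exprVn mulfK ?expf_neq0.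
Qed.

Lemma pow_congr1 j y k : O y -> O ((y - 1) / p%:R ^+ j) -> O ((y ^+ k - 1) / p%:R ^+ j).
Proof.
move=> Oy O1; rewrite subrX1 mulrAC; apply: (vringM vO) => //.
by apply: (vring_sum vO) => i _; apply: (vringX vO).
Qed.

(** In [y^p - 1 = (y - 1) * sum_(i < p) y^i], the sum is congruent to [p], hence
    divisible by [p]. *)
Lemma pow_prime_congr1 j y : (0 < j)%N -> O y -> O ((y - 1) / p%:R ^+ j) ->
  O ((y ^+ p - 1) / p%:R ^+ j.+1).
Proof.
case: j => // j _ Oy O1; rewrite subrX1 [p%:R ^+ j.+2]exprSr.
have -> : \sum_(i < p) y ^+ i = p%:R + \sum_(i < p) (y ^+ i - 1).
  by rewrite big_split /= sumrN sumr_const card_ord addrCA subrr addr0.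
have -> : (y - 1) * (p%:R + \sum_(i < p) (y ^+ i - 1)) / (p%:R ^+ j.+1 * p%:R) =
   (y - 1) / p%:R ^+ j.+1 * (1 + p%:R ^+ j * \sum_(i < p) ((y ^+ i - 1) / p%:R ^+ j.+1)).
  by rewrite -mulr_suml [p%:R ^+ j.+1]exprS; field; rewrite p0 pX0.
apply: (vringM vO) => //; apply: (vringD vO); first exact: (vring1 vO).
apply: (vringM vO); first by apply: (vringX vO); apply: (vring_nat vO).
by apply: (vring_sum vO) => i _; apply: pow_congr1.
Qed.

Lemma unit_congr1 x d : x != 0 -> O x -> O x^-1 ->
  exists2 N, (0 < N)%N & O ((x ^+ N - 1) / p%:R ^+ d).
Proof.
move=> x0 Ox Ox'; have [N N0 ON] := padic_unit pO x0 Ox Ox'.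
suff [N' N'0 ON'] : exists2 N, (0 < N)%N & O ((x ^+ N - 1) / p%:R ^+ d.+1).
  exists N' => //; have -> : (x ^+ N' - 1) / p%:R ^+ d = (x ^+ N' - 1) / p%:R ^+ d.+1 * p%:R.
    by rewrite exprSr; field; rewrite p0 pX0.
  by apply: (vringM vO) => //; apply: (vring_nat vO).
elim: d => [|d [N' N'0 IH]]; first by exists N; rewrite // expr1.
exists (N' * p)%N; first by rewrite muln_gt0 N'0 prime_gt0.
by rewrite exprM; apply: pow_prime_congr1 => //; apply: (vringX vO).
Qed.

(** One exponent for finitely many units; exponents may be multiplied. *)
Lemma common_exponent d (l : seq K) : exists2 N, (0 < N)%N &
  forall x, x \in l -> x != 0 -> O x -> O x^-1 -> O ((x ^+ N - 1) / p%:R ^+ d).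
Proof.
elim: l => [|y l [N N0 IH]]; first by exists 1%N.
have [N' N'0 HN'] : exists2 N', (0 < N')%N &
    (y != 0 -> O y -> O y^-1 -> O ((y ^+ N' - 1) / p%:R ^+ d)).
  have [[y0 Oy Oy']|ny] := pselect [/\ y != 0, O y & O y^-1].
    by have [N' N'0 H] := unit_congr1 d y0 Oy Oy'; exists N'.
  by exists 1%N => // y0 Oy Oy'; case: ny.
exists (N * N')%N => [|x]; first by rewrite muln_gt0 N0.
rewrite in_cons => /orP[/eqP->|xl] x0 Ox Ox'.
  by rewrite mulnC exprM; apply: pow_congr1; [apply: (vringX vO) | apply: HN'].
by rewrite exprM; apply: pow_congr1; [apply: (vringX vO) | apply: IH].
Qed.

Lemma vring_rat_logn (y : rat) C :
  O (p%:R ^+ C * ratr y) -> (logn p `|denq y| <= C)%N.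
Proof.
move=> Oy; rewrite leqNgt; apply/negP => lt; apply: OpN.
have d_gt0 : (0 < `|denq y|)%N by rewrite absz_gt0 denq_eq0.
have /dvdnP[k ek] : (p ^ C.+1 %| `|denq y|)%N by rewrite pfactor_dvdn.
have k0 : k%:R != 0 :> K.
  by rewrite pnatr_eq0; apply: contraTneq d_gt0 => k0; rewrite ek k0.
have dE : (denq y)%:~R = k%:R * p%:R ^+ C.+1 :> K.
  by rewrite -absz_denq ek -[LHS]/((k * p ^ C.+1)%N%:R) natrM natrX.
have [u [v e]] := Bezoutz (numq y) (denq y).
have e1 : u%:~R * (numq y)%:~R + v%:~R * (denq y)%:~R = 1 :> K.
  rewrite -!rmorphM -rmorphD /= e (_ : gcdz _ _ = 1) //.
  by apply/eqP; rewrite eqz_nat; exact: coprime_num_den.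
have nE : (numq y)%:~R = ratr y * (denq y)%:~R :> K.
  by rewrite /ratr divfK // intr_eq0 denq_eq0.
have -> : p%:R^-1 = k%:R * (u%:~R * (p%:R ^+ C * ratr y) + v%:~R * p%:R ^+ C) :> K.
  apply: (mulIf p0); rewrite mulVf // -[LHS]e1 nE dE exprSr; ring.
apply: (vringM vO); first exact: (vring_nat vO).
have Ov (z : int) t : O t -> O (z%:~R * t) by apply: (vringM vO); apply: (vring_int vO).
by apply: (vringD vO); apply: Ov => //; apply: (vringX vO); apply: (vring_nat vO).
Qed.

End UnitPowers.

(** The modulus [Q0] makes the ratios of roots of equal absolute value congruent
    to 1 modulo [p^d] after raising them to the power [Q]. *)
Lemma clustered_class_bounded (m : nat) (a : 'I_m -> int) (x : nat -> rat_mod_int) p :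
  satisfies_inverse_monic_recurrence a x -> prime p ->
  exists2 Q0, (0 < Q0)%N & forall Q r, (0 < Q)%N -> (Q0 %| Q)%N ->
    clustered [set n | x (r + Q * n)%N = 0] ->
    exists C, forall n y, rat_class y = x (r + Q * n)%N -> (logn p `|denq y| <= C)%N.
Proof.
move=> hx p_pr.
have [ O pO] := exists_padic_ring p_pr algC_algebraic.
have vO : valuation_ring O := pO.
set d := (size (rec_poly a rat)).-1.
have [s es] := closed_field_poly_normal (rec_poly a algC).
rewrite -/(root_poly s) in es.
have lc0 : lead_coef (rec_poly a algC) != 0 by rewrite lead_coef_eq0 rec_poly_neq0.
have ss : size s = d.
  rewrite /d -(size_rec_poly_rat a algC) es size_scale //.
  by rewrite /root_poly size_prod_XsubC.
have s1 b : b \in s -> b != 0 /\ O b^-1.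
  move=> bs; apply: (rec_poly_root (a := a) vO).
  by rewrite es rootZ // /root_poly root_prod_XsubC.
have [Q0 Q0_gt0 HQ0] := common_exponent p_pr pO d [seq b / c | b <- s, c <- s].
exists Q0 => // Q r Q_gt0 /dvdnP[k eQ] clA.
pose sQ := [seq ('X^Q : {poly algC}).[b] | b <- s].
have ssQ : size sQ = d by rewrite size_map.
have sQ1 b : b \in sQ -> b != 0 /\ O b^-1.
  move=> /mapP[c /s1[c0 Oc] ->]; rewrite hornerXn expf_neq0 // -exprVn.
  by split=> //; apply: (vringX vO).
have /choice[w hw] k1 := rat_class_surj (x (r + Q * k1)%N).
have [C HC] : exists C, forall k, (k < d)%N -> O (p%:R ^+ C * ratr (w k)).
  elim: (d) => [|e [C IH]]; first by exists 0%N.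
  have [c Oc] := padic_bounded pO (ratr (w e)); exists (C + c)%N => i.
  rewrite ltnS leq_eqVlt => /orP[/eqP->|/IH].
    by apply: (vring_pow_le pO) Oc; apply: leq_addl.
  by apply: (vring_pow_le pO); apply: leq_addr.
have Oclass C0 y y' : rat_class y = rat_class y' ->
    O (p%:R ^+ C0 * ratr y) -> O (p%:R ^+ C0 * ratr y').
  move=> e Oy; have /rat_class_eq0/intrP[z ez] : rat_class (y' - y) = 0.
    by rewrite raddfB /= e subrr.
  have -> : y' = y + z%:~R by rewrite -ez addrC subrK.
  rewrite rmorphD /= ratr_int mulrDr; apply: (vringD vO) => //.
  apply: (vringM vO); last exact: (vring_int vO).
  by apply: (vringX vO); apply: (vring_nat vO).
have [|||C' HC'] := peel p_pr pO (d := d) clA (s := sQ) C.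
- by rewrite ssQ.
- exact: sQ1.
- move=> _ _ /mapP[b bs ->] /mapP[c cs ->]; rewrite !hornerXn -!expr_div_n => Obc Ocb.
  have [b0 _] := s1 b bs; have [c0 _] := s1 c cs.
  have {}Obc := vring_root pO Q_gt0 Obc; have {}Ocb := vring_root pO Q_gt0 Ocb.
  rewrite eQ mulnC exprM; apply: (pow_congr1 pO); first exact: (vringX vO).
  apply: HQ0; rewrite ?mulf_neq0 ?invr_eq0 ?invf_div //.
  by apply/allpairsP; exists (b, c).
exists C' => n y ey; apply: (vring_rat_logn p_pr pO).
have [B' HB'] := HC' n.
(* Far enough to include the values that control index [n], the index [n]
   itself and the initial values. *)
have [u Pu hu] := rational_lift (r + Q * (B' + n + d)).+1 hx.
have {}hu k' : (k' <= B' + n + d)%N -> rat_class (u (r + Q * k')%N) = x (r + Q * k')%N.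
  move=> le; apply: hu; rewrite ltn_addr // ltnS leq_add2l leq_mul2l le orbT //.
apply: (Oclass _ (u (r + Q * n)%N)); first by rewrite ey hu // -addnA addnCA leq_addr.
pose v k := appl (fun i => ratr (u i) : algC) ('X^r * 'X^Q ^+ k).
have vE k' : v k' = ratr (u (r + Q * k')%N).
  by rewrite /v -exprM -exprD applXn.
rewrite -vE; apply: (HB' v) => // [|k' lt|k' Ak leB].
- apply: annih_map; apply: annih_dvd (annih_ratr (F := algC) Pu) _.
  by rewrite es dvdpZl.
- rewrite ssQ in lt; rewrite vE.
  apply: (Oclass _ (w k')); first by rewrite hw hu // ltnW // ltn_addl.
  by apply: HC.
- rewrite vE; apply: (Oclass _ 0); last by rewrite rmorph0 mulr0; apply: vring0.
  by rewrite raddf0 hu ?Ak // -addnA (leq_trans leB) ?leq_addr.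
Qed.

Lemma rat_mod_int_torsion (x : rat_mod_int) : exists2 B, (0 < B)%N & x *+ B = 0.
Proof.
have [y <-] := rat_class_surj x; exists `|denq y|%N; first by rewrite absz_gt0 denq_eq0.
exact/denq_dvd.
Qed.

(** Solving the recurrence for its last term divides by the last nonzero
    coefficient, so every prime in the order of some [x n] divides that
    coefficient or the order of an initial value. *)
Lemma recurrence_torsion (m : nat) (a : 'I_m -> int) (x : nat -> rat_mod_int) :
  satisfies_inverse_monic_recurrence a x ->
  exists2 b, (0 < b)%N & forall n, exists k, x n *+ (b ^ k)%N = 0.
Proof.
move=> hx; case: (pickP (fun i => a i != 0)) => [i0 ai0|a0]; last first.
  exists 1%N => // n; exists 0%N; rewrite mulr1n -(hx n) big1 ?add0r // => i _.
  by have /negbT := a0 i; rewrite negbK => /eqP ->; rewrite mulr0z.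
have [i1 /= ai1 amax] := @arg_maxnP _ i0 (fun i => a i != 0) (fun i : 'I_m => i : nat) ai0.
have [N0 N0_gt0 HN0] : exists2 N0, (0 < N0)%N & forall i, (i < i1.+1)%N -> x i *+ N0 = 0.
  elim: i1.+1 => [|e [N N_gt0 IH]]; first by exists 1%N.
  have [B B0 HB] := rat_mod_int_torsion (x e).
  exists (N * B)%N => [|i]; first by rewrite muln_gt0 N_gt0.
  rewrite ltnS leq_eqVlt => /orP[/eqP->|/IH e0]; last by rewrite mulrnA e0 mul0rn.
  by rewrite mulnC mulrnA HB mul0rn.
pose b := (N0 * `|a i1|)%N.
exists b => [|n]; first by rewrite muln_gt0 N0_gt0 absz_gt0.
suff [k Hk] : exists k, forall j, (j < n + i1.+1)%N -> x j *+ (b ^ k)%N = 0.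
  by exists k; apply: Hk; rewrite addnS ltnS leq_addr.
elim: n => [|n [k IH]].
  by exists 1%N => j /HN0 e; rewrite expn1 mulrnA e mul0rn.
exists k.+1 => j; rewrite addSn ltnS leq_eqVlt => /orP[/eqP->|/IH e]; last first.
  by rewrite expnSr mulrnA e mul0rn.
have := hx n; rewrite (bigD1 i1) //= -addrA => /eqP.
rewrite addr_eq0 => /eqP e.
have : x (n + i1.+1)%N *+ (b ^ k)%N *~ a i1 = 0.
  rewrite pmulrn -mulrzA mulrC mulrzA -pmulrn.
  rewrite e mulNrn mulrnDl IH ?addr0; last by rewrite addnS ltnS leq_addr.
  rewrite -sumrMnl big1 ?oppr0 // => i ii1.
  have [ai|ai] := eqVneq (a i) 0; first by rewrite ai mulr0z mul0rn.
  rewrite pmulrn -mulrzA mulrC mulrzA -pmulrn IH ?mul0rz //.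
  rewrite ltn_add2l ltnS ltn_neqAle amax // andbT.
  by apply: contraNneq ii1 => e'; apply/eqP/val_inj.
move=> e'; have -> : (b ^ k.+1 = b ^ k * `|a i1| * N0)%N.
  by rewrite expnSr -mulnA; congr muln; apply: mulnC.
rewrite mulrnA mulrnA; suff -> : x (n + i1.+1)%N *+ (b ^ k)%N *+ `|a i1| = 0 by rewrite mul0rn.
by case: (a i1) e' => z; rewrite // NegzE mulrNz => /eqP; rewrite oppr_eq0 => /eqP.
Qed.

(** Orders involve only the primes dividing [b]; [clustered_class_bounded]
    bounds the exponent of each of them. *)
Lemma class_torsion (m : nat) (a : 'I_m -> int) (x : nat -> rat_mod_int) :
  satisfies_inverse_monic_recurrence a x ->
  exists2 Q, (0 < Q)%N & forall r, clustered [set n | x (r + Q * n)%N = 0] ->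
    exists2 M, (0 < M)%N & forall n, x (r + Q * n)%N *+ M = 0.
Proof.
move=> hx; have [b b0 Hb] := recurrence_torsion hx.
have /choice[Q0 HQ0] p : exists Q0, (0 < Q0)%N /\ (prime p -> forall Q r, (0 < Q)%N ->
    (Q0 %| Q)%N -> clustered [set n | x (r + Q * n)%N = 0] ->
    exists C, forall n y, rat_class y = x (r + Q * n)%N -> (logn p `|denq y| <= C)%N).
  case: (boolP (prime p)) => [p_pr|_]; last by exists 1%N.
  by have [Q0 Q0_gt0 H] := clustered_class_bounded hx p_pr; exists Q0; split=> // _.
pose Q := (\prod_(p <- primes b) Q0 p)%N.
have Q_gt0 : (0 < Q)%N by rewrite /Q prodn_gt0 // => p; case: (HQ0 p).
exists Q => // r clA.
have /choice[C HC] p : exists C, p \in primes b ->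
    forall n y, rat_class y = x (r + Q * n)%N -> (logn p `|denq y| <= C)%N.
  case: (boolP (p \in primes b)) => [pb|_]; last by exists 0%N.
  have p_pr : prime p by move: pb; rewrite mem_primes => /andP[].
  have [_ /(_ p_pr Q r Q_gt0)] := HQ0 p.
  case=> // [|C HC]; last by exists C.
  by rewrite /Q (big_rem p) //= dvdn_mulr.
exists (\prod_(p <- primes b) p ^ C p)%N.
  rewrite big_seq prodn_cond_gt0 // => p; rewrite mem_primes expn_gt0 => /andP[/prime_gt0 -> _] //.
move=> n; have [y ey] := rat_class_surj (x (r + Q * n)%N).
rewrite -ey denq_dvd.
have D0 : (0 < `|denq y|)%N by rewrite absz_gt0 denq_eq0.
apply/(dvdn_partP _ D0) => p; rewrite -[p \in _]/(p \in primes _) => pD.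
have p_pr : prime p by move: pD; rewrite mem_primes => /andP[].
have [k Hk] := Hb (r + Q * n)%N.
have pb : p \in primes b.
  rewrite mem_primes p_pr b0 /=; rewrite -ey denq_dvd in Hk.
  have : (p %| b ^ k)%N.
    by apply: dvdn_trans Hk; move: pD; rewrite mem_primes => /and3P[].
  by rewrite Euclid_dvdX // => /andP[].
rewrite p_part (big_rem p) //= dvdn_mulr // dvdn_exp2l //.
exact: HC ey.
Qed.

(** * Periodicity and the zero set *)

(** The companion matrix [A] maps the state at [n + 1] to the state at [n].  By
    Cayley-Hamilton, [A ^+ Q] is a root of its characteristic polynomial, monic
    with integer coefficients, which gives an inverse monic recurrence on each
    residue class modulo [Q]. *)
Lemma class_recurrence (m : nat) (a : 'I_m -> int) (x : nat -> rat_mod_int) Q :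
  (0 < m)%N -> satisfies_inverse_monic_recurrence a x ->
  exists c : 'I_m -> int, forall n, \sum_(i < m) x (n + Q * (m - i))%N *~ c i + x n = 0.
Proof.
case: m a => // m a _ hx.
pose A : 'M[int]_m.+1 := \matrix_(j, i) if j == 0 then - a i else (j == i.+1 :> nat)%:R.
pose E : 'M[rat]_m.+1 := map_mx intr A.
pose chi := char_poly (A ^+ Q).
have chi_m : chi`_m.+1 = 1.
  have /monicP := char_poly_monic (A ^+ Q).
  by rewrite lead_coefE size_char_poly.
exists (fun i => chi`_i) => n.
have [u Pu hu] := rational_lift (n + Q * m.+1).+1 hx.
pose U k : 'cV[rat]_m.+1 := \col_i u (k + i)%N.
have EU k : E *m U k.+1 = U k.
  apply/colP => j; rewrite !mxE; case: (unliftP ord0 j) => [j'|] ->.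
    rewrite (bigD1 (widen_ord (leqnSn m) j')) //= !mxE /= eqxx mul1r big1 ?addr0.
      by rewrite /bump leq0n addSn addnS.
    move=> i ij; rewrite !mxE /= eqSS; case: eqP => [e|_]; last by rewrite mul0r.
    by case/eqP: ij; apply: val_inj.
  rewrite addn0; have := Pu 'X^k; rewrite appl_rec_poly => /eqP.
  rewrite addr_eq0 => /eqP ->; rewrite -sumrN; apply: eq_bigr => i _.
  by rewrite !mxE eqxx rmorphN mulNr addSnnS.
have EkU k l : E ^+ k *m U (l + k)%N = U l.
  elim: k l => [|k IHk] l; first by rewrite expr0 mul1mx addn0.
  by rewrite exprSr -mulmxA addnS EU IHk.
have CH : \sum_(i < m.+2) (chi`_i)%:~R *: E ^+ (Q * i) = 0.
  have := Cayley_Hamilton (E ^+ Q).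
  have -> : E ^+ Q = map_mx intr (A ^+ Q) by rewrite rmorphXn.
  rewrite -map_char_poly -/chi => e0; rewrite -[RHS]e0.
  rewrite -[map_poly _ _]coefK poly_def rmorph_sum.
  have -> : size (map_poly intr chi : {poly rat}) = m.+2.
    by rewrite size_map_poly_id0 ?size_char_poly //
       (monicP (char_poly_monic _)) oner_eq0.
  apply: eq_bigr => i _ /=; rewrite coef_map /=.
  by rewrite linearZ /= rmorphXn /= horner_mx_X exprM rmorphXn.
have := congr1 (fun V => (V *m U (n + Q * m.+1)%N) 0 0) CH.
rewrite mul0mx [RHS]mxE mulmx_suml summxE => e.
have {}e : \sum_(i < m.+2) (chi`_i)%:~R * u (n + Q * (m.+1 - i))%N = 0.
  rewrite -[RHS]e; apply: eq_bigr => i _.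
  have le : (i <= m.+1)%N by rewrite -ltnS.
  rewrite -scalemxAl mxE; congr (_ * _).
  rewrite -[X in U X](_ : n + Q * (m.+1 - i) + Q * i = _)%N.
    by rewrite EkU mxE addn0.
  by rewrite -addnA -mulnDr subnK.
have := congr1 rat_class e; rewrite big_ord_recr /= chi_m mul1r subnn muln0 addn0.
rewrite raddf0 raddfD /= raddf_sum /= hu ?ltn_addr ?ltnS ?leq_addr // => e'.
rewrite -[RHS]e'; congr (_ + _); apply: eq_bigr => i _.
by rewrite mulrzl raddfMz /= hu // ltn_addr // ltnS leq_add2l leq_mul2l leq_subr orbT.
Qed.

Lemma torsion_representative (M : nat) (x : rat_mod_int) : (0 < M)%N -> x *+ M = 0 ->
  exists i : 'I_M, x = rat_class (i%:R / M%:R).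
Proof.
move=> M0; have [y <-] := rat_class_surj x.
have M1 : M%:R != 0 :> rat by rewrite pnatr_eq0 -lt0n.
rewrite -raddfMn rat_class_eq0 -[y *+ M]mulr_natr => /intrP[z ez].
have Mz : (M%:Z != 0) by rewrite eqz_nat -lt0n.
have r0 : (0 <= (z %% M)%Z) by apply: modz_ge0.
have rM : (`|(z %% M)%Z| < M)%N by rewrite -ltz_nat gez0_abs // ltz_pmod.
exists (Ordinal rM) => /=; apply/eqP; rewrite -subr_eq0 -raddfB; apply/eqP.
apply/rat_class_eq0; suff -> : y - `|(z %% M)%Z|%:R / M%:R = (z %/ M)%Z%:~R.
  exact: intr_int.
apply: (mulIf M1); rewrite mulrBl divfK // ez.
rewrite -[(`|_|%N)%:R]/(`|(z %% M)%Z|%:Z%:~R : rat) gez0_abs //.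
rewrite {1}(divz_eq z M) rmorphD rmorphM /= addrK //.
Qed.

(** Two equal states have equal pasts.  Far out, two states at a distance at most
    the number of states coincide, whence a period, valid on a long initial
    segment, that divides the factorial of that number. *)
Lemma torsion_periodic (m M : nat) (c : 'I_m -> int) (y : nat -> rat_mod_int) :
  (0 < M)%N -> (forall n, y n *+ M = 0) ->
  (forall n, \sum_(i < m) y (n + (m - i))%N *~ c i + y n = 0) ->
  exists2 T, (0 < T)%N & forall n, y (n + T)%N = y n.
Proof.
move=> M0 yM rec.
have /choice[g hg] n := torsion_representative M0 (yM n).
pose f n : {ffun 'I_m -> 'I_M} := [ffun i : 'I_m => g (n + i)%N].
pose same s t := forall i, (i < m)%N -> y (s + i)%N = y (t + i)%N.
have same_y s t : same s.+1 t.+1 -> y s = y t.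
  move=> e; apply: (addrI (\sum_(i < m) y (s + (m - i))%N *~ c i)).
  rewrite rec -[LHS](rec t); congr (_ + _); apply: eq_bigr => i _.
  have -> : (m - i = (m - i.+1).+1)%N by have := ltn_ord i; lia.
  by rewrite -!addSnnS e //; have := ltn_ord i; lia.
have back s t k : same (s + k)%N (t + k)%N -> same s t.
  elim: k s t => [|k IHk] s t; first by rewrite !addn0.
  rewrite -!addSnnS => /IHk e i im.
  case: i im => [|i] im; first by rewrite !addn0; apply: same_y.
  by rewrite -!addSnnS e // ltnW.
pose T := factorial #|{ffun 'I_m -> 'I_M}|.
exists T => [|n]; first exact: fact_gt0.
have [s [t [ns st tS est]]] := pigeonhole f (n + T).
have sst : same s t.
  move=> i im; have /ffunP/(_ (Ordinal im)) := est; rewrite !ffunE /= => e.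
  by rewrite hg e -hg.
have step k : (k < s)%N -> y (k + (t - s))%N = y k.
  move=> ks; symmetry; apply: same_y; apply: (back _ _ (s - k.+1)%N).
  by rewrite subnKC // (_ : ((k + (t - s)).+1 + (s - k.+1))%N = t) //; lia.
have /dvdnP[j ej] : (t - s %| T)%N.
  by apply: dvdn_fact; rewrite subn_gt0 st leq_subLR (leq_trans tS) ?leq_add2r.
rewrite ej in ns *; elim: j ns {ej} => [|j IHj] ns; first by rewrite addn0.
rewrite mulSn addnCA addnC step; last by move: ns; rewrite mulSn; lia.
by apply: IHj; move: ns; rewrite mulSn; lia.
Qed.

Section AlmostPeriodic.
Variable R : realType.

Lemma very_sparse_almost_periodic (A : set nat) : very_sparse R A -> almost_periodic R A.
Proof.
move=> vA; exists set0, A; split=> //.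
by rewrite bigcup_set0 set0U.
Qed.

Lemma very_sparse_set0 : very_sparse R set0.
Proof.
apply: not_clustered_very_sparse => /(_ 1%N 0%N 0%N)[D [[|n l] [_ //= _ H]]].
by have [] := H n (mem_head _ _).
Qed.

Lemma arithmetic_progression_almost_periodic (A : set nat) :
  arithmetic_progression A -> almost_periodic R A.
Proof.
move=> apA; exists [set A], set0; split;
  [exact: finite_set1 | by move=> _ -> | exact: very_sparse_set0 |].
by rewrite bigcup_set1 setU0.
Qed.

Lemma very_sparseU (A B : set nat) :
  very_sparse R A -> very_sparse R B -> very_sparse R (A `|` B).
Proof.
move=> vA vB m m0; apply/eqoP => e e0; near=> n.
have le : ((initial_count (A `|` B) n)%:R : R) <=
    (initial_count A n)%:R + (initial_count B n)%:R.
  rewrite -natrD ler_nat !initial_count_iota -count_predUI.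
  apply: leq_trans (leq_addr _ _); apply: sub_count => i /set_mem[] H.
    by apply/orP; left; apply: mem_set.
  by apply/orP; right; apply: mem_set.
have hA : `|(initial_count A n)%:R : R| <= e / 2 * `|iterated_log m (n%:R : R)|.
  by near: n; have /eqoP := vA m m0; apply; rewrite divr_gt0.
have hB : `|(initial_count B n)%:R : R| <= e / 2 * `|iterated_log m (n%:R : R)|.
  by near: n; have /eqoP := vB m m0; apply; rewrite divr_gt0.
rewrite !normr_nat in hA hB *.
apply: le_trans le _; apply: le_trans (lerD hA hB) _.
by rewrite -mulrDl -splitr.
Unshelve. all: by end_near. Qed.

Lemma almost_periodicU (A B : set nat) :
  almost_periodic R A -> almost_periodic R B -> almost_periodic R (A `|` B).
Proof.
move=> [F [S [fF apF vS ->]]] [G [T [fG apG vT ->]]].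
exists (F `|` G), (S `|` T); split.
- by rewrite finite_setU.
- by move=> P [/apF|/apG].
- exact: very_sparseU.
- by rewrite bigcup_setU setUACA.
Qed.

Lemma almost_periodic_bigcup (N : nat) (A : nat -> set nat) :
  (forall r, (r < N)%N -> almost_periodic R (A r)) ->
  almost_periodic R [set n | exists2 r, (r < N)%N & A r n].
Proof.
elim: N => [|N IHN] apA.
  rewrite (_ : mkset _ = set0); last by apply/seteqP; split=> n // [].
  exact: very_sparse_almost_periodic very_sparse_set0.
rewrite (_ : mkset _ = [set n | exists2 r, (r < N)%N & A r n] `|` A N).
  apply: almost_periodicU; last exact: apA.
  by apply: IHN => r rN; apply: apA; apply: ltnW.
apply/seteqP; split=> n /=.
  by case=> r; rewrite ltnS leq_eqVlt => /orP[/eqP->|lt] An; [right | left; exists r].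
by case=> [[r lt An]|An]; [exists r; first exact: ltnW | exists N].
Qed.

Lemma class_almost_periodic (m : nat) (x : nat -> rat_mod_int) Q r :
  (0 < Q)%N -> (0 < m)%N ->
  (exists c : 'I_m -> int,
     forall n, \sum_(i < m) x (n + Q * (m - i))%N *~ c i + x n = 0) ->
  (clustered [set n | x (r + Q * n)%N = 0] ->
    exists2 M, (0 < M)%N & forall n, x (r + Q * n)%N *+ M = 0) ->
  almost_periodic R [set n | exists2 k, n = (r + Q * k)%N & x n = 0].
Proof.
move=> Q0 m0 [c hc] tors.
have [/tors[M M0 xM]|ncl] := pselect (clustered [set n | x (r + Q * n)%N = 0]).
  have [|T T0 per] := @torsion_periodic m M c (fun k => x (r + Q * k)%N) M0 xM.
    move=> n; rewrite -[RHS](hc (r + Q * n)%N); congr (_ + _).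
    by apply: eq_bigr => i _; rewrite mulnDr addnA.
  pose A j := if x (r + Q * j)%N == 0 then
    [set (r + Q * j + Q * T * k)%N | k in [set: nat]] else set0.
  have perk j k : x (r + Q * (j + T * k))%N = x (r + Q * j)%N.
    elim: k => [|k IHk]; first by rewrite muln0 addn0.
    by rewrite mulnS [(T + _)%N]addnC addnA -IHk; apply: (per (j + T * k)%N).
  rewrite (_ : mkset _ = [set n | exists2 j, (j < T)%N & A j n]).
    apply: almost_periodic_bigcup => j _; rewrite /A; case: ifP => _.
      by apply: arithmetic_progression_almost_periodic; exists (r + Q * j)%N, (Q * T)%N.
    exact: very_sparse_almost_periodic very_sparse_set0.
  have split_index k j : (r + Q * j + Q * T * k = r + Q * (j + T * k))%N.
    by rewrite mulnDr mulnA addnA.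
  apply/seteqP; split=> n /=.
    case=> k -> xk; exists (k %% T)%N; first by rewrite ltn_mod.
    have ek : k = (k %% T + T * (k %/ T))%N by rewrite {1}(divn_eq k T) addnC mulnC.
    move: xk; rewrite {1}ek perk => xk; rewrite /A xk eqxx.
    by exists (k %/ T)%N; rewrite // split_index -ek.
  case=> j jT; rewrite /A; case: eqP => [xj|_ //] [k _ <-].
  by rewrite split_index; exists (j + T * k)%N; rewrite ?perk.
(* A cluster of numbers [r + Q * k] gives a cluster of indices [k]. *)
apply/very_sparse_almost_periodic/not_clustered_very_sparse => cl; apply: ncl => K a b.
have [D [l [ul sl lA]]] := cl K (Q * a)%N (Q * b + r)%N.
have key n : n \in l -> [/\ n = (r + Q * ((n - r) %/ Q))%N, x n = 0,
    (a * D + b <= (n - r) %/ Q)%N & (n < 2 ^ D)%N].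
  move=> /lA[[k -> xk] le lt].
  by rewrite addKn mulKn //; split=> //; move: le; nia.
exists D, [seq ((n - r) %/ Q)%N | n <- l]; split.
- rewrite map_inj_in_uniq // => i j /key[ei _ _ _] /key[ej _ _ _] e.
  by rewrite ei ej e.
- by rewrite size_map.
- move=> _ /mapP[n /key[en xn le lt] ->]; split=> //; first by rewrite /= -en.
  by apply: leq_ltn_trans lt; rewrite (leq_trans (leq_div _ _)) ?leq_subr.
Qed.

End AlmostPeriodic.

Theorem proposition1p8 (R : realType) (m : nat) (x : nat -> rat_mod_int) :
  (1 <= m)%N ->
  inverse_monic_lrs m x ->
  almost_periodic R [set n : nat | x n = 0].
Proof.
move=> m0 [a hx]; have [Q Q0 HQ] := class_torsion hx.
rewrite (_ : mkset _ = [set n | exists2 r, (r < Q)%N &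
    [set n | exists2 k, n = (r + Q * k)%N & x n = 0] n]).
  apply: almost_periodic_bigcup => r _.
  apply: (class_almost_periodic R Q0 m0 _ (HQ r)).
  exact: class_recurrence m0 hx.
apply/seteqP; split=> n /=; last by case=> r _ [].
move=> xn; exists (n %% Q)%N; first by rewrite ltn_mod.
by exists (n %/ Q)%N => //; rewrite {1}(divn_eq n Q) addnC mulnC.
Qed.
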